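(* Let $K$ be a compact space. Then the following conditions are equivalent: (i) $\mathcal{C}(K)$ has a $1$-projectional skeleton. (ii) There is a convex symmetric set induced by a retractional skeleton in $(B_{\mathcal{C}(K)^*},w^* )$. (iii) There is a convex set induced by a retractional skeleton in $(B_{\mathcal{C}(K)^*},w^* )$. (iv) There is a convex set induced by a retractional skeleton in $P(K)$.
   Context: All topological spaces are Hausdorff; Banach spaces are real. $\mathcal{C}(K)$ is the Banach space of continuous real functions on $K$ with the supremum norm; $B_X$ denotes the closed unit ball of a Banach space $X$; $w^*$ is the weak$^*$ topology. $P(K)$ is the space of (Radon) probability measures on $K$ with the $w^*$-topology, viewed as a compact subset of $(\mathcal{C}(K)^*,w^* )$. A partially ordered set $\Gamma$ is up-directed if any two elements have an upper bound in $\Gamma$, and $\sigma$-complete if every increasing sequence in $\Gamma$ has a supremum in $\Gamma$. A projectional skeleton in a Banach space $X$ is a family $\{P_s\}_{s\in\Gamma}$ of bounded linear projections on $X$, indexed by an up-directed $\sigma$-complete partially ordered set $\Gamma$, such that: (i) each $P_sX$ is separable; (ii) $X=\bigcup_{s\in\Gamma}P_sX$; (iii) $s\le t\Rightarrow P_s=P_s\circ P_t=P_t\circ P_s$; (iv) if $s_1<s_2<\cdots$ in $\Gamma$ and $t=\sup_n s_n$, then $P_tX=\overline{\bigcup_n P_{s_n}X}$. It is an $r$-projectional skeleton ($r\ge1$) if moreover $\|P_s\|\le r$ for all $s\in\Gamma$. A retractional skeleton in a compact space $L$ is a family $\{r_s\}_{s\in\Gamma}$ of (continuous) retractions of $L$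 into itself, indexed by an up-directed $\sigma$-complete partially ordered set $\Gamma$, such that: (i) $r_s[L]$ is metrizable for each $s$; (ii) $x=\lim_{s\in\Gamma}r_s(x)$ for every $x\in L$; (iii) $s\le t\Rightarrow r_s=r_s\circ r_t=r_t\circ r_s$; (iv) if $s_1<s_2<\cdots$ in $\Gamma$ and $t=\sup_n s_n$, then $r_t(x)=\lim_n r_{s_n}(x)$ for every $x\in L$. The set induced by this retractional skeleton is $\bigcup_{s\in\Gamma}r_s[L]$. *)

(* Defs.v *)
From HB Require Import structures.
From mathcomp Require Import all_boot all_order all_algebra.
From mathcomp Require Import all_classical all_reals all_analysis.
From mathcomp Require Import ring.

Set Implicit Arguments.
Unset Strict Implicit.
Unset Printing Implicit Defensive.

Import Order.TTheory GRing.Theory Num.Theory.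
Import numFieldNormedType.Exports.

Local Open Scope classical_set_scope.
Local Open Scope ring_scope.

(* Compactness is a parameter of the type because the supremum is a norm only *)
(* on bounded functions.                                                      *)
Definition cfun (R : realType) (K : topologicalType)
  (Kc : compact [set: K]) : Type := continuousType K R.

Section cfun_normed.
Context {R : realType} {K : topologicalType} (Kc : compact [set: K]).
Local Notation C := (cfun R Kc).

Definition continuous_pred : {pred K -> R} :=
  mem [set f : K -> R | continuous f].

Definition cfun_Sub (f : K -> R) (fP : f \in continuous_pred) : C :=
  HB.pack f (isContinuous.Build K R f (set_mem fP)).

Definition cfun_val (f : C) : K -> R := f.

Lemma cfun_rect (P : C -> Type) :
  (forall f (fP : f \in continuous_pred), P (cfun_Sub fP)) -> forall u, P u.
Proof.
move=> Psub u.
have uP : cfun_val u \in continuous_pred by apply: mem_set; exact: cts_fun.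
suff -> : u = cfun_Sub uP by exact: Psub.
exact/continuousEP.
Qed.

Lemma cfun_valP f (fP : f \in continuous_pred) :
  cfun_val (cfun_Sub fP) = f.
Proof. by []. Qed.

HB.instance Definition _ := isSub.Build _ _ C cfun_rect cfun_valP.
HB.instance Definition _ := [Choice of C by <:].

Lemma continuous_submod_closed : submod_closed continuous_pred.
Proof.
split; first by apply: mem_set => x; exact: cst_continuous.
move=> a f g /set_mem fc /set_mem gc; apply: mem_set => x.
by apply: cvgD; [apply: cvgZr; exact: fc|exact: gc].
Qed.

HB.instance Definition _ :=
  GRing.isSubmodClosed.Build _ _ continuous_pred continuous_submod_closed.
HB.instance Definition _ := [SubChoice_isSubLmodule of C by <:].

Definition sup_norm (f : C) : R := sup [set `|cfun_val f x| | x in [set: K]].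

Let has_ubound_cfun (f : C) :
  has_ubound [set `|cfun_val f x| | x in [set: K]].
Proof.
have fc : continuous (cfun_val f) by exact: cts_fun.
have /compact_bounded[M [_ fM]] : compact (cfun_val f @` [set: K]).
  by apply: continuous_compact => //; exact: continuous_subspaceT.
exists (M + 1) => _ [x _ <-]; apply: fM; last by exists x.
by rewrite ltrDl.
Qed.

Lemma sup_norm_ub (f : C) x : `|cfun_val f x| <= sup_norm f.
Proof. by apply: ub_le_sup; [exact: has_ubound_cfun|exists x]. Qed.

Lemma sup_norm_le (f : C) M :
  0 <= M -> (forall x, `|cfun_val f x| <= M) -> sup_norm f <= M.
Proof.
move=> M0 fM; rewrite /sup_norm; set A := (X in sup X).
have [->|A0] := eqVneq A set0; first by rewrite sup0.
by apply: ge_sup; [exact/set0P|move=> _ [x _ <-]].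
Qed.

Lemma sup_norm_ge0 (f : C) : 0 <= sup_norm f.
Proof.
rewrite /sup_norm; set A := (X in sup X).
have [->|/set0P[_ [x _ _]]] := eqVneq A set0; first by rewrite sup0.
by rewrite (le_trans _ (sup_norm_ub f x)).
Qed.

Let sup_normD (f g : C) : sup_norm (f + g) <= sup_norm f + sup_norm g.
Proof.
apply: sup_norm_le => [|x]; first by rewrite addr_ge0// sup_norm_ge0.
by rewrite (le_trans (ler_normD _ _))// lerD// sup_norm_ub.
Qed.

Let sup_normZ (a : R) (f : C) : sup_norm (a *: f) = `|a| * sup_norm f.
Proof.
have le b (g : C) : sup_norm (b *: g) <= `|b| * sup_norm g.
  apply: sup_norm_le => [|x]; first by rewrite mulr_ge0// sup_norm_ge0.
  by rewrite (normrM b (cfun_val g x)) ler_wpM2l// sup_norm_ub.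
apply/eqP; rewrite eq_le le/=.
have [->|a0] := eqVneq a 0; first by rewrite normr0 mul0r sup_norm_ge0.
rewrite mulrC -ler_pdivlMr ?normr_gt0// mulrC -normfV.
by rewrite -[in leLHS](scalerK a0 f) le.
Qed.

Let sup_norm0_eq0 (f : C) : sup_norm f = 0 -> f = 0.
Proof.
move=> f0; apply/val_inj/funext => x; apply/normr0_eq0/eqP.
by rewrite eq_le normr_ge0 andbT -f0 sup_norm_ub.
Qed.

HB.instance Definition _ :=
  Lmodule_isNormed.Build R C sup_normD sup_normZ sup_norm0_eq0.

Lemma cfun_normE (f : C) : `|f| = sup_norm f.
Proof. by []. Qed.

Let cfun_ballE (f g : C) e x :
  ball f e g -> `|cfun_val f x - cfun_val g x| < e.
Proof.
by rewrite -ball_normE/=; apply: le_lt_trans; exact: (sup_norm_ub (f - g) x).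
Qed.

Let cfun_complete (F : set_system C) :
  ProperFilter F -> cauchy F -> cvg F.
Proof.
move=> FF /cauchyP Fc.
have Fx x : cvg ((fun g : C => cfun_val g x) @ F).
  apply: cauchy_cvg; apply: cauchy_exP => e e0.
  have [f Ff] := Fc e e0; exists (cfun_val f x).
  by apply: (@filterS _ F _ (ball f e)) => // g; exact: cfun_ballE.
pose l x := lim ((fun g : C => cfun_val g x) @ F).
have Fl e : 0 < e -> \forall g \near F, forall x, `|l x - cfun_val g x| < e.
  move=> e0; have e20 : 0 < e / 3 by rewrite divr_gt0.
  have [f Ff] := Fc _ e20; near=> g => x; near F => h.
  have fg : `|cfun_val f x - cfun_val g x| < e / 3.
    by apply: cfun_ballE; near: g.
  have fh : `|cfun_val f x - cfun_val h x| < e / 3.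
    by apply: cfun_ballE; near: h.
  have lh : `|l x - cfun_val h x| < e / 3.
    by near: h; move/cvgrPdist_lt : (Fx x); exact.
  have -> : l x - cfun_val g x = (l x - cfun_val h x) +
      (cfun_val h x - cfun_val f x) + (cfun_val f x - cfun_val g x).
    by rewrite !subrKA.
  rewrite (le_lt_trans (ler_normD _ _))//.
  rewrite (_ : e = e / 3 + e / 3 + e / 3); last by field.
  rewrite ltrD// (le_lt_trans (ler_normD _ _))// ltrD//.
  by rewrite distrC.
have lc : continuous l.
  move=> x; apply/cvgrPdist_lt => e e0.
  have e20 : 0 < e / 3 by rewrite divr_gt0.
  near F => g.
  have lg : forall y, `|l y - cfun_val g y| < e / 3 by near: g; exact: Fl.
  have gc : continuous (cfun_val g) by exact: cts_fun.
  have := gc x => /cvgrPdist_lt/(_ _ e20); apply: filterS => y gxy.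
  have -> : l x - l y = (l x - cfun_val g x) +
      (cfun_val g x - cfun_val g y) + (cfun_val g y - l y).
    by rewrite !subrKA.
  rewrite (le_lt_trans (ler_normD _ _))//.
  rewrite (_ : e = e / 3 + e / 3 + e / 3); last by field.
  rewrite ltrD//; last by rewrite distrC.
  by rewrite (le_lt_trans (ler_normD _ _))// ltrD.
apply/cvg_ex; exists (cfun_Sub (mem_set lc)).
apply/cvgrPdist_le => e e0; near=> g.
apply: sup_norm_le => [|x]; first exact: ltW.
by apply/ltW; move: (x); near: g; exact: Fl.
Unshelve. all: by end_near. Qed.

HB.instance Definition _ := Uniform_isComplete.Build C cfun_complete.

End cfun_normed.

Section dual.
Context {R : realType} (X : normedModType R).

Definition dual_pred : {pred X -> R} :=
  mem [set f : X -> R | linear f /\ continuous f].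

Record dual := Dual {
  dual_val :> X -> R;
  dual_valP : dual_val \in dual_pred }.

HB.instance Definition _ := [isSub for dual_val].
HB.instance Definition _ := [Choice of dual by <:].

Lemma dual_submod_closed : submod_closed dual_pred.
Proof.
split.
  apply: mem_set; split=> [a x y|x]; last exact: cst_continuous.
  by rewrite (_ : _ + _ = a *: (0 : R) + 0)// scaler0 addr0.
move=> a f g /set_mem[fl fc] /set_mem[gl gc]; apply: mem_set; split.
  by move=> b x y; rewrite !fctE fl gl !scalerDr addrACA !scalerA mulrC.
by move=> x; apply: cvgD; [apply: cvgZl_tmp; exact: fc|exact: gc].
Qed.

HB.instance Definition _ :=
  GRing.isSubmodClosed.Build _ _ dual_pred dual_submod_closed.
HB.instance Definition _ := [SubChoice_isSubLmodule of dual by <:].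

Definition weak_star : Type :=
  initial_topology (fun phi : dual => (phi : {ptws X -> R})).
HB.instance Definition _ := Topological.on weak_star.

End dual.

(* The supremum of an unbounded set is 0 by convention, so this is the        *)
(* operator norm only when f is bounded.                                      *)
Definition op_norm {R : realType} {X Y : normedModType R} (f : X -> Y) : R :=
  sup [set `|f x| | x in [set x | `|x| <= 1]].

Definition dual_ball {R : realType} (X : normedModType R) :
  set (weak_star X) := [set phi : dual X | op_norm phi <= 1].
Arguments dual_ball {R} X.

(* Measurable types are pointed in the library, hence the base point; the     *)
(* Borel sigma-algebra does not depend on it.                                 *)
Definition pointed_at (K : topologicalType) (x0 : K) : Type := K.
HB.instance Definition _ (K : topologicalType) (x0 : K) :=
  Choice.copy (pointed_at x0) K.
HB.instance Definition _ (K : topologicalType) (x0 : K) :=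
  isPointed.Build (pointed_at x0) x0.

Definition borel (K : topologicalType) (x0 : K) :=
  g_sigma_algebraType (@open K : set (set (pointed_at x0))).
HB.instance Definition _ (K : topologicalType) (x0 : K) :=
  Measurable.copy (borel x0)
    (g_sigma_algebraType (@open K : set (set (pointed_at x0)))).

(* A probability measure is locally finite, so being Radon amounts to inner   *)
(* regularity with respect to compact sets.                                   *)
Definition radon {R : realType} {K : topologicalType} {x0 : K}
  (mu : probability (borel x0) R) :=
  forall A : set K, (@measurable _ (borel x0)) A ->
    mu A = ereal_sup [set mu C | C in [set C : set K | compact C /\ C `<=` A]].

(* Radon probability measures, identified with the functionals f |-> \int f;  *)
(* the set is empty when K is.                                                *)
Definition radon_probabilities (R : realType) {K : topologicalType}
  (Kc : compact [set: K]) : set (weak_star (cfun R Kc)) :=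
  [set phi : dual (cfun R Kc) |
    exists (x0 : K) (mu : probability (borel x0) R), radon mu /\
      forall f, (phi f)%:E = (\int[mu]_x (cfun_val f x)%:E)%E].
Arguments radon_probabilities R {K} Kc.

Section skeletons.
Context {disp : Order.disp_t} {I : porderType disp}.

(* Nonemptiness is implicit in directedness: along an empty index set the     *)
(* filter of tails is improper and converges to every point.                  *)
Definition up_directed :=
  [set: I] !=set0 /\ forall s t : I, exists u, (s <= u)%O /\ (t <= u)%O.

Definition sigma_complete := forall s : nat -> I,
  (forall n, (s n <= s n.+1)%O) -> supremums (range s) !=set0.

Definition tails : set_system I :=
  filter_from [set: I] (fun s => [set t | (s <= t)%O]).

Definition separable (T : topologicalType) :=
  exists2 D : set T, countable D & dense D.

Definition metrizable (R : realType) (T : topologicalType) :=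
  exists (M : metricType R) (f : T -> M) (g : M -> T),
    [/\ continuous f, continuous g, cancel f g & cancel g f].

Record projectional_skeleton {R : realType} {X : completeNormedModType R}
    (P : I -> X -> X) : Prop := {
  projectional_directed : up_directed;
  projectional_complete : sigma_complete;
  projectional_linear : forall s, linear (P s);
  projectional_bounded : forall s, bounded_fun_norm (P s);
  projectional_idem : forall s x, P s (P s x) = P s x;
  projectional_separable : forall s, separable (set_type (range (P s)));
  projectional_cover : [set: X] = \bigcup_s range (P s);
  projectional_comp : forall s t, (s <= t)%O ->
    P s = P s \o P t /\ P s = P t \o P s;
  projectional_sup : forall (s : nat -> I) t,
    (forall n, (s n < s n.+1)%O) -> supremums (range s) t ->
    range (P t) = closure (\bigcup_n range (P (s n))) }.

Record retractional_skeleton (R : realType) {L : topologicalType}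
    (r : I -> L -> L) : Prop := {
  retractional_directed : up_directed;
  retractional_complete : sigma_complete;
  retractional_continuous : forall s, continuous (r s);
  retractional_idem : forall s x, r s (r s x) = r s x;
  retractional_metrizable : forall s, metrizable R (set_type (range (r s)));
  retractional_cvg : forall x, r s x @[s --> tails] --> x;
  retractional_comp : forall s t, (s <= t)%O ->
    r s = r s \o r t /\ r s = r t \o r s;
  retractional_sup : forall (s : nat -> I) t,
    (forall n, (s n < s n.+1)%O) -> supremums (range s) t ->
    forall x, r (s n) x @[n --> \oo] --> r t x }.

End skeletons.

Definition has_projectional_skeleton {R : realType} (c : R)
    (X : completeNormedModType R) :=
  exists (disp : Order.disp_t) (I : porderType disp) (P : I -> X -> X),
    projectional_skeleton P /\ forall s, op_norm (P s) <= c.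

Definition skeleton_induced (R : realType) {L : topologicalType} (D : set L) :=
  exists (disp : Order.disp_t) (I : porderType disp) (r : I -> L -> L),
    retractional_skeleton R r /\ D = \bigcup_s range (r s).

Definition symmetric_set {V : zmodType} (A : set V) :=
  forall x, A x -> A (- x).

(* Convexity and symmetry of a subset of a subspace A of the dual make sense  *)
(* only for its image in the ambient vector space.                            *)
Definition in_dual {R : realType} {X : normedModType R} {A : set (weak_star X)}
  (D : set (set_type A)) : set (dual X) := set_val @` D.

(* Main.v *)
Require Import Defs.
From HB Require Import structures.
From mathcomp Require Import all_boot all_order all_algebra.
From mathcomp Require Import all_classical all_reals all_analysis.
From mathcomp Require Import ring lra.

Set Implicit Arguments.
Unset Strict Implicit.
Unset Printing Implicit Defensive.

Import Order.TTheory GRing.Theory Num.Theory.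
Import numFieldNormedType.Exports.

Local Open Scope classical_set_scope.
Local Open Scope ring_scope.

(** Write C for the space of continuous functions on K, B for the dual ball
    and P for the space of Radon probability measures.

    By the Riesz representation theorem (radon_probabilitiesE), P is the set of
    states: the functionals of norm at most 1 with value 1 at the constant
    function 1. Hence P is a closed face of B, and it is weak-star compact by
    the Banach-Alaoglu theorem (dual_ball_compact).

    From (i) to (ii) the adjoints of the projections, restricted to B, form a
    retractional skeleton (dual_ball_skeleton); the set that it induces is the
    intersection of B with a directed union of subspaces, hence convex and
    symmetric. The passage from (ii) to (iii) is trivial.

    From (iii) to (iv), the key fact is that a continuous function f on a
    compact space with a retractional skeleton satisfies f (r t x) = f x for all
    large t (skeleton_factor). Applied to the evaluation at the constant 1, it
    says that P is invariant under r t for large t, so that these r t restrict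
    to a skeleton of P (skeleton_induced_fiber), and the set induced in P is
    the intersection of P with the given convex set.

    From (iv) to (i), put P_s f x = (r s delta_x) f, where delta_x is the Dirac
    measure at x. These operators are linear of norm at most 1, but they compose
    well only if (r s mu) f = mu (P_s f) for every measure mu, that is, if r s
    is affine: both sides are then continuous affine functions of mu that agree
    at the Dirac measures (state_barycenter). The convexity of the induced set
    yields cofinally many affine r s, by a closing-off argument
    (hom_index_cofinal): along a sequence s_n, one fixes countably many points
    of the induced set, together with their midpoints, that witness the
    behaviour of r s_n on all pairs; the retraction at the supremum then
    preserves midpoints. The set of these s is closed under suprema of
    sequences, so that it indexes a projectional skeleton. *)

(** * Ultrafilters, subspaces and countable sets *)

Lemma ultra_cvg_compact_set (T : Type) (L : topologicalType) (A : set L)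
    (U : set_system T) (u : T -> L) : UltraFilter U -> compact A ->
  (\forall k \near U, A (u k)) -> exists2 l : L, A l & u @ U --> l.
Proof.
move=> UU Ac uA; have [l [Al lu]] := Ac (u @ U) _ uA; exists l => // V Vl.
have [//|UV] := in_ultra_setVsetC (u @^-1` V) UU.
by have [z []] := lu (~` V) V UV Vl.
Qed.

Lemma ultra_cvg_compact (T : Type) (L : topologicalType) (U : set_system T)
    (u : T -> L) : UltraFilter U -> compact [set: L] ->
  exists l : L, u @ U --> l.
Proof.
move=> UU Lc; have [|l _ ul] := ultra_cvg_compact_set (u := u) UU Lc.
  exact: filterT.
by exists l.
Qed.

Lemma cvg_initial (S : choiceType) (T : topologicalType) (f : S -> T)
    (F : set_system S) (s : initial_topology f) : Filter F ->
  f @ F --> f s -> F --> s.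
Proof.
move=> FF fF V /= [_ [[B Bo <-] Bfs BV]].
have /fF FB : nbhs (f s) B by apply: open_nbhs_nbhs.
by apply: filterS BV _; exact: FB.
Qed.

Lemma cvg_set_type (T : Type) (L : topologicalType) (A : set L)
    (F : set_system T) (u : T -> set_type A) (x : set_type A) : Filter F ->
  (fun k => set_val (u k)) @ F --> set_val x -> u @ F --> x.
Proof. by move=> FF; apply: (@cvg_initial _ _ set_val (u @ F)). Qed.

Lemma continuous_to_set_type (T L : topologicalType) (A : set L)
    (u : T -> set_type A) :
  continuous (fun k => set_val (u k)) -> continuous u.
Proof. by move=> uc x; apply: cvg_set_type; exact: uc. Qed.

Lemma continuous_set_val (L : topologicalType) (A : set L) :
  continuous (set_val : set_type A -> L).
Proof. exact: initial_continuous. Qed.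

Lemma compact_set_type (L : topologicalType) (A : set L) :
  compact A -> compact [set: set_type A].
Proof.
move=> Ac; rewrite compact_ultra => F UF _.
have [|l Al ul] := ultra_cvg_compact_set (u := set_val : set_type A -> L) UF Ac.
  by apply: filterE => x; exact: set_valP.
exists (SigSub (mem_set Al)); split=> //.
exact: (@cvg_set_type _ _ A F id (SigSub (mem_set Al))).
Qed.

Lemma hausdorff_set_type (L : topologicalType) (A : set L) :
  hausdorff_space L -> hausdorff_space (set_type A).
Proof.
move=> Lh x y xy; apply/val_inj/Lh => U V Ux Vy.
have [||z [Uz Vz]] := xy (set_val @^-1` U) (set_val @^-1` V).
- exact: continuous_set_val.
- exact: continuous_set_val.
by exists (set_val z).
Qed.

Lemma hausdorff_cvg_eq (T : Type) (L : topologicalType) (F : set_system T)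
    (u : T -> L) (y z : L) : ProperFilter F -> hausdorff_space L ->
  u @ F --> y -> u @ F --> z -> y = z.
Proof.
by move=> FF Lh uy uz; exact: (@cvg_unique _ Lh (u @ F) _ y z uy uz).
Qed.

Lemma ultra_nat : exists2 U : set_system nat, UltraFilter U & \oo `<=` U.
Proof. by have [U [UU ?]] := ultraFilterLemma eventually_filter; exists U. Qed.

Lemma countable_setU (T : Type) (A B : set T) :
  countable A -> countable B -> countable (A `|` B).
Proof.
move=> Ac Bc; rewrite -bigcup2E; apply: bigcup_countable => // -[|[|i]] _ //=.
Qed.

(** * Sequences of indices *)

Section sequences_in_skeleton.
Context {disp : Order.disp_t} {I : porderType disp}.

Lemma nondecreasing_seq_le (s : nat -> I) :
  (forall n, (s n <= s n.+1)%O) -> forall m n, (m <= n)%N -> (s m <= s n)%O.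
Proof.
move=> sS m n; elim: n => [|n ih]; first by rewrite leqn0 => /eqP ->.
by rewrite leq_eqVlt ltnS => /predU1P[->//|/ih/le_trans]; apply.
Qed.

(** The continuity axioms of skeletons concern strictly increasing sequences,
    while recursive constructions only give nondecreasing ones. *)
Lemma nondecreasing_seq_cst_or_incr (s : nat -> I) (t : I) :
    (forall n, (s n <= s n.+1)%O) -> supremums (range s) t ->
  (exists N, s N = t) \/
  (exists phi : nat -> nat, (forall k, (s (phi k) < s (phi k.+1))%O) /\
    supremums (range (s \o phi)) t).
Proof.
move=> sS [ts st].
have sle := nondecreasing_seq_le sS.
have [[N sN]|Ncst] := pselect (exists N, forall n, (N <= n)%N -> s n = s N).
  left; exists N; apply/eqP; rewrite eq_le; apply/andP; split.
    by apply: ts; exists N.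
  apply: st => _ [n _ <-]; have [Nn|/ltnW nN] := leqP N n.
    by rewrite (sN n).
  exact: sle.
right.
have next N : exists n, (s N < s n)%O /\ (N < n)%N.
  apply: contrapT => H; apply: Ncst; exists N => n Nn.
  apply/eqP; rewrite eq_le (sle N n Nn) andbT; apply: contrapT => nle.
  apply: H; exists n; split.
    by rewrite lt_def (sle N n Nn) andbT; apply: contra_notN nle => /eqP ->.
  by rewrite ltn_neqAle Nn andbT; apply: contra_notN nle => /eqP ->.
have [nx nxP] := choice next.
pose phi := fun k => iter k nx 0%N; exists phi; split=> [k|].
  by rewrite /phi/=; have [] := nxP (iter k nx 0%N).
have phik k : (k <= phi k)%N.
  elim: k => // k ih; rewrite /phi/=; have [_] := nxP (iter k nx 0%N).
  exact: leq_ltn_trans.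
split=> [_ [k _ <-]|u us]; first by apply: ts; exists (phi k).
apply: st => _ [k _ <-]; apply: (@le_trans _ _ (s (phi k))); first exact: sle.
by apply: us; exists k.
Qed.

Lemma sup_nondecreasing_interleave (s u : nat -> I) (t : I) :
    (forall n, (s n <= u n)%O) -> (forall n, (u n <= s n.+1)%O) ->
  supremums (range s) t -> supremums (range u) t.
Proof.
move=> su us [ts st]; split=> [_ [n _ <-]|v vu].
  by apply: (le_trans (us n)); apply: ts; exists n.+1.
by apply: st => _ [n _ <-]; apply: (le_trans (su n)); apply: vu; exists n.
Qed.

Lemma countable_index_ubound (C : set I) : @up_directed _ I ->
  @sigma_complete _ I -> countable C -> exists t, forall s, C s -> (s <= t)%O.
Proof.
move=> [[i0 _] dir] sc /pfcard_geP[->|[e]]; first by exists i0.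
have ex (p : I * nat) : exists u, (p.1 <= u)%O /\ (e p.2 <= u)%O.
  exact: dir.
have [nx nxP] := choice ex.
pose s := fix s n := if n is k.+1 then nx (s k, k) else i0.
have [|t [ts _]] := sc s; first by move=> n; have [] := nxP (s n, n).
exists t => c Cc; have [n _ <-] := 'surj_e Cc.
apply: (@le_trans _ _ (s n.+1)); first by have [] := nxP (s n, n).
by apply: ts; exists n.+1.
Qed.

Lemma tails_proper : @up_directed _ I -> ProperFilter (@tails _ I).
Proof.
move=> [[i0 _] dir]; apply: filter_from_proper; last first.
  by move=> i _; exists i => /=.
apply: filter_from_filter; first by exists i0.
move=> s t _ _; have [u [su tu]] := dir s t; exists u => // v /= uv.
by split; [exact: le_trans uv|exact: le_trans uv].
Qed.

End sequences_in_skeleton.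

(** * Limits along a retractional skeleton *)

Section skeleton_limits.
Context {R : realType} {disp : Order.disp_t} {I : porderType disp}.
Context {L : topologicalType} (Lc : compact [set: L]) (Lh : hausdorff_space L).
Context {r : I -> L -> L} (rS : retractional_skeleton R r).

Let rc s : continuous (r s).
Proof. exact: (retractional_continuous rS). Qed.

Lemma skeleton_le_l s t x : (s <= t)%O -> r s (r t x) = r s x.
Proof. by move=> /(retractional_comp rS)[/(congr1 (fun g => g x)) /= <- _]. Qed.

Lemma skeleton_le_r s t x : (s <= t)%O -> r t (r s x) = r s x.
Proof. by move=> /(retractional_comp rS)[_ /(congr1 (fun g => g x)) /= <-]. Qed.

Lemma skeleton_fix_le s t x : (s <= t)%O -> r s x = x -> r t x = x.
Proof. by move=> st sx; rewrite -{1}sx skeleton_le_r. Qed.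

Lemma skeleton_cvg_eq (s : I) (T : Type) (G : set_system T)
    (u v : T -> L) (y z : L) : ProperFilter G ->
    u @ G --> y -> v @ G --> z -> (\forall k \near G, r s (u k) = r s (v k)) ->
  r s y = r s z.
Proof.
move=> GG uy vz uv.
have ru : (r s \o u) @ G --> r s y by apply: continuous_cvg => //; exact: rc.
have rv : (r s \o v) @ G --> r s z by apply: continuous_cvg => //; exact: rc.
apply: (hausdorff_cvg_eq _ Lh ru).
by apply: cvg_trans rv; apply: near_eq_cvg; near=> k; apply/esym; near: k.
Unshelve. all: by end_near. Qed.

(** The retractions r (s n) determine r t: along a suitable subsequence they
    converge to it pointwise. *)
Lemma skeleton_sup_eq (s : nat -> I) t y z :
    (forall n, (s n <= s n.+1)%O) -> supremums (range s) t ->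
  (forall n, r (s n) y = r (s n) z) -> r t y = r t z.
Proof.
move=> sS st yz; have [[N <-]//|[phi [phiS phit]]] :=
  nondecreasing_seq_cst_or_incr sS st.
have yt : r (s (phi n)) y @[n --> \oo] --> r t y.
  exact: (retractional_sup rS phiS phit).
apply: (hausdorff_cvg_eq _ Lh yt).
under eq_fun do rewrite yz.
exact: (retractional_sup rS phiS phit).
Qed.

(** Pointwise convergence improves to uniform convergence by compactness. If
    the points x_k are bad for indices n_k that tend to infinity, then limits
    y and z of r t x_k and of r (s n_k) x_k along an ultrafilter have the same
    image under every r (s n) and lie in the range of r t, whence y = z; but f
    separates y from z. *)
Lemma skeleton_sup_unif (f : L -> R) (s : nat -> I) t (e : R) : continuous f ->
    (forall n, (s n <= s n.+1)%O) -> supremums (range s) t -> 0 < e ->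
  exists N, forall n x, (N <= n)%N -> `|f (r (s n) x) - f (r t x)| < e.
Proof.
move=> fc sS st e0; apply: contrapT => H.
have bad N : exists p : nat * L,
    (N <= p.1)%N /\ e <= `|f (r (s p.1) p.2) - f (r t p.2)|.
  apply: contrapT => H'; apply: H; exists N => n x Nn.
  by rewrite ltNge; apply/negP => he; apply: H'; exists (n, x).
have [p pP] := choice bad.
have [U UU oU] := ultra_nat.
pose y k := r t (p k).2; pose z k := r (s (p k).1) (p k).2.
have [y0 yy0] := ultra_cvg_compact y UU Lc.
have [z0 zz0] := ultra_cvg_compact z UU Lc.
have sle := nondecreasing_seq_le sS.
have slt n : (s n <= t)%O by have [st' _] := st; apply: st'; exists n.
have y0t : r t y0 = y0.
  apply: (hausdorff_cvg_eq _ Lh _ yy0).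
  have : r t (y k) @[k --> U] --> r t y0.
    by apply: continuous_cvg => //; exact: rc.
  rewrite (_ : (fun x => r t (y x)) = y)//; apply/funext => k.
  exact: (retractional_idem rS).
have z0t : r t z0 = z0.
  apply: (hausdorff_cvg_eq _ Lh _ zz0).
  have : r t (z k) @[k --> U] --> r t z0.
    by apply: continuous_cvg => //; exact: rc.
  rewrite (_ : (fun x => r t (z x)) = z)//; apply/funext => k.
  exact: skeleton_le_r.
have yz0 : y0 = z0.
  rewrite -y0t -z0t; apply: (skeleton_sup_eq sS st) => n.
  apply: (skeleton_cvg_eq _ yy0 zz0) => //.
  apply: oU; exists n => // k /= nk; rewrite /y /z !skeleton_le_l//.
  by apply: sle; rewrite (leq_trans nk)//; have [] := pP k.
have fy : f (y k) @[k --> U] --> f y0 by apply: continuous_cvg => //; exact: fc.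
have fz : f (z k) @[k --> U] --> f y0.
  by rewrite yz0; apply: continuous_cvg => //; exact: fc.
have : (f (z k) - f (y k)) @[k --> U] --> f y0 - f y0 by exact: cvgB.
rewrite subrr => /cvgr0_norm_lt/(_ _ e0) => /filter_ex[k].
by rewrite ltNge; have [_ ->] := pP k.
Qed.

(** If f o r_t does not converge uniformly to f, there are indices
    t_0 <= u_0 <= t_1 <= u_1 <= ... such that f o r_(t_n) and f o r_(u_n) stay
    apart. Both sequences of indices have the same supremum t, and both
    sequences of functions converge uniformly to f o r_t, a contradiction. So
    f o r_t is uniformly close to f for large t, and equality holds above the
    supremum of countably many indices. *)
Lemma skeleton_factor (f : L -> R) : continuous f ->
  exists s, forall t x, (s <= t)%O -> f (r t x) = f x.
Proof.
move=> fc.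
have dir := retractional_directed rS; have sc := retractional_complete rS.
have ub := fun C => @countable_index_ubound _ _ C dir sc.
have tailsP := tails_proper dir.
have approx (e : R) : 0 < e -> exists s, forall t x, (s <= t)%O ->
    `|f x - f (r t x)| <= e.
  move=> e0; apply: contrapT => H.
  have bad s : exists p : I * I, [/\ (s <= p.1)%O, (p.1 <= p.2)%O &
      exists x, e < `|f (r p.2 x) - f (r p.1 x)|].
    apply: contrapT => H'; apply: H; exists s => t x stt.
    rewrite leNgt; apply/negP => ex; apply: H'.
    have fr : `|f (r u x) - f (r t x)| @[u --> @tails _ I] -->
        `|f x - f (r t x)|.
      apply: cvg_norm; apply: cvgB; last exact: cvg_cst.
      apply: continuous_cvg; [exact: fc|exact: (retractional_cvg rS)].
    have tt : \forall u \near @tails _ I, (t <= u)%O by exists t.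
    have [u [tu eu]] := filter_ex (filterI tt (cvgr_gt _ fr _ ex)).
    by exists (t, u); split=> //; exists x.
  have [nx nxP] := choice bad.
  have [[i0 _] _] := dir.
  (* q n is the pair (t_n, u_n); the next pair starts above u_n. *)
  pose q := fix q n := if n is k.+1 then nx (q k).2 else nx i0.
  have q12 n : ((q n).1 <= (q n).2)%O.
    by case: n => [|n]; [have [] := nxP i0|have [] := nxP (q n).2].
  have q21 n : ((q n).2 <= (q n.+1).1)%O by have [] := nxP (q n).2.
  have qe n : exists x, e < `|f (r (q n).2 x) - f (r (q n).1 x)|.
    by case: n => [|n]; [have [] := nxP i0|have [] := nxP (q n).2].
  have q1 n : ((q n).1 <= (q n.+1).1)%O by exact: le_trans (q12 n) (q21 n).
  have q2 n : ((q n).2 <= (q n.+1).2)%O by exact: le_trans (q21 n) (q12 n.+1).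
  have [t t1] := sc _ q1.
  have t2 := sup_nondecreasing_interleave q12 q21 t1.
  have e20 : 0 < e / 2 by rewrite divr_gt0.
  have [N1 N1P] := skeleton_sup_unif fc q1 t1 e20.
  have [N2 N2P] := skeleton_sup_unif fc q2 t2 e20.
  have [x] := qe (maxn N1 N2); apply/negP; rewrite -leNgt.
  rewrite (splitr e) -(subrKA (f (r t x))) (le_trans (ler_normD _ _))// lerD//.
    by apply/ltW/N2P; rewrite leq_maxr.
  by rewrite distrC; apply/ltW/N1P; rewrite leq_maxl.
have [s sP] := choice (fun n : nat => approx n.+1%:R^-1 ltac:(by [])).
have [t tP] := ub (range s) (sub_countable (card_image_le _ _) (countableP _)).
exists t => u x tu; apply/esym/eqP; rewrite -subr_eq0 -normr_le0.
apply/ler_addgt0Pl => e e0; rewrite addr0.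
have [n] := ltr_add_invr e0; rewrite add0r => /ltW; apply: le_trans.
by apply: sP; apply: le_trans tu; apply: tP; exists n.
Qed.

End skeleton_limits.

(** * Indices at which the retraction commutes with an operation *)

(** A countable base of the subspace A, given by open sets of the whole space:
    this spares the transfer of points between L and the type of A. *)
Definition countable_base_on (L : topologicalType) (A : set L) :=
  exists2 W : nat -> set L, (forall n, open (W n)) &
    forall x V, A x -> nbhs x V -> exists2 n, W n x & W n `&` A `<=` V.

Lemma metrizable_second_countable (R : realType) (T : topologicalType) :
  compact [set: T] -> metrizable R T -> @second_countable T.
Proof.
move=> Tc [M [f [g [fc gc fg gf]]]].
have [x0|T0] := pselect ([set: T] !=set0); last first.
  exists set0; first exact: countable0.
  by split=> // x; exfalso; apply: T0; exists x.
have [{}x0 _] := x0.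
pose M' : pseudoPMetricType R := HB.pack M (isPointed.Build M (f x0)).
have M'c : compact [set: M'].
  have -> : [set: M'] = f @` [set: T].
    by rewrite eqEsubset; split=> // y _; exists (g y) => //; exact: gf.
  by apply: continuous_compact => //; apply: continuous_subspaceT.
have [B Bc [Bo Bb]] := compact_second_countable M'c.
exists [set f @^-1` b | b in B].
  by apply: sub_countable Bc; exact: card_image_le.
split=> [_ [b /Bo bo <-]|x V xV]; first by move/continuousP : fc; exact.
have : nbhs (f x) (g @^-1` V) by apply: gc; rewrite fg.
move=> /(Bb (f x))[b [Bb' bfx] bV]; exists (f @^-1` b).
  by split => //; exists b.
by move=> y /= /bV; rewrite /= fg.
Qed.

Lemma second_countable_base_on (L : topologicalType) (A : set L) :
  @second_countable (set_type A) -> countable_base_on A.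
Proof.
move=> [B Bc [Bo Bb]].
have [B0|[e]] := pfcard_geP Bc.
  exists (fun=> set0) => [n|x V Ax xV]; first exact: open0.
  have [b [+ _]] := Bb (SigSub (mem_set Ax)) setT filterT.
  by rewrite B0.
have ex n : exists W : set L,
    open W /\ set_val @^-1` W = e n :> set (set_type A).
  by have [W Wo We] := Bo (e n) ('funS_e Logic.I); exists W.
have [W WP] := choice ex.
exists W => [n|x V Ax xV]; first by have [] := WP n.
have := Bb (SigSub (mem_set Ax)) (set_val @^-1` V).
case; first exact: (@continuous_set_val _ A (SigSub (mem_set Ax)) V).
move=> b [Bb' bx] bV.
have [n _ nb] := 'surj_e Bb'; exists n.
  have [_ /(congr1 (fun X => X (SigSub (mem_set Ax))))] := WP n.
  by rewrite nb /= => ->.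
move=> y [Wy Ay]; apply: (bV (SigSub (mem_set Ay))).
have [_ WE] := WP n.
have : (set_val @^-1` W n) (SigSub (mem_set Ay)) by [].
by rewrite WE nb.
Qed.

Section sample.
Context {L : topologicalType} (A : set L) (Ab : countable_base_on A).

(** The range of P under the map (u, v, w) into A x A x A is separable: pick
    one point of P for each product of three basic open sets that meets that
    range. *)
Lemma countable_sample (E : Type) (P : set E) (u v w : E -> L) :
    (forall e, P e -> [/\ A (u e), A (v e) & A (w e)]) ->
  exists2 C : set E, countable C /\ C `<=` P &
    forall e U V W, P e -> nbhs (u e) U -> nbhs (v e) V -> nbhs (w e) W ->
      exists2 c, C c & [/\ U (u c), V (v c) & W (w c)].
Proof.
move=> uvw; have [B Bo Bb] := Ab.
pose good (n : nat * nat * nat) (e : E) :=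
  [/\ P e, B n.1.1 (u e), B n.1.2 (v e) & B n.2 (w e)].
have [E0|nE] := pselect (P !=set0); last first.
  exists set0; first by split; [exact: countable0|].
  by move=> e U V W Pe; exfalso; apply: nE; exists e.
have [e0 Pe0] := E0.
have ex n : exists e, P e /\ ((exists e, good n e) -> good n e).
  have [[e ge]|ne] := pselect (exists e, good n e); last by exists e0.
  by exists e; split=> //; case: ge.
have [c cP] := choice ex.
exists (range c).
  split; first exact: (sub_countable (card_image_le _ _) (countableP _)).
  by move=> _ [n _ <-]; have [] := cP n.
move=> e U V W Pe Ue Ve We; have [Au Av Aw] := uvw e Pe.
have [i Bi Ui] := Bb _ _ Au Ue; have [j Bj Vj] := Bb _ _ Av Ve.
have [k Bk Wk] := Bb _ _ Aw We.
have [_ /(_ (ex_intro _ e _))[//|Pc c1 c2 c3]] := cP (i, j, k).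
exists (c (i, j, k)); first by exists (i, j, k).
have [A1 A2 A3] := uvw _ Pc.
by split; [apply: Ui|apply: Vj|apply: Wk].
Qed.

End sample.

Section homomorphic_indices.
Context {R : realType} {disp : Order.disp_t} {I : porderType disp}.
Context {L : topologicalType} (Lc : compact [set: L]) (Lh : hausdorff_space L).
Context {r : I -> L -> L} (rS : retractional_skeleton R r).
Context (m : L -> L -> L) (mc : continuous (fun p : L * L => m p.1 p.2)).

Let rc s : continuous (r s).
Proof. exact: (retractional_continuous rS). Qed.

Let r_cvg s (T : Type) (F : set_system T) (u : T -> L) (x : L) : Filter F ->
  u @ F --> x -> r s (u k) @[k --> F] --> r s x.
Proof. by move=> FF ux; apply: continuous_cvg ux; exact: rc. Qed.

Definition hom_index := [set t | forall x y, r t (m x y) = m (r t x) (r t y)].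

Let m_cvg (T : Type) (F : set_system T) (u v : T -> L) x y : Filter F ->
  u @ F --> x -> v @ F --> y -> m (u k) (v k) @[k --> F] --> m x y.
Proof. by move=> FF; apply: continuous2_cvg; exact: (@mc (x, y)). Qed.

Lemma hom_index_sup (s : nat -> I) t : (forall n, (s n <= s n.+1)%O) ->
  supremums (range s) t -> (forall n, hom_index (s n)) -> hom_index t.
Proof.
move=> sS st sm; have [[N <-]//|[phi [phiS phit]]] :=
  nondecreasing_seq_cst_or_incr sS st.
have rt x : r (s (phi n)) x @[n --> \oo] --> r t x.
  exact: (retractional_sup rS phiS phit).
move=> x y; apply: (hausdorff_cvg_eq _ Lh (rt _)).
by under eq_fun do rewrite sm; exact: m_cvg.
Qed.

Let D := \bigcup_s range (r s).

Let DP x : D x <-> exists s, r s x = x.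
Proof.
split=> [[s _ [y _ <-]]|[s sx]]; last by exists s => //; exists x.
by exists s; exact: (retractional_idem rS).
Qed.

Lemma skeleton_range_base s : countable_base_on (range (r s)).
Proof.
apply/second_countable_base_on/metrizable_second_countable; last first.
  exact: (retractional_metrizable rS).
apply/compact_set_type/continuous_compact => //.
by apply: continuous_subspaceT; exact: rc.
Qed.

Let D_fix (C : set L) s0 : countable C -> C `<=` D ->
  exists2 t, (s0 <= t)%O & forall x, C x -> r t x = x.
Proof.
move=> Cc CD.
have ex x : exists s, C x -> r s x = x.
  have [/CD/DP[s sx]|nC] := pselect (C x); last by exists s0.
  by exists s.
have [f fP] := choice ex.
have [|t tP] := @countable_index_ubound _ I (s0 |` (f @` C))
    (retractional_directed rS) (retractional_complete rS).
  apply: countable_setU; first exact: countable1.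
  by apply: sub_countable Cc; exact: card_image_le.
exists t; first by apply: tP; left.
move=> x Cx; apply: (skeleton_fix_le rS) (fP x Cx).
by apply: tP; right; exists x.
Qed.

(** Start from s_0 = s0. At stage n, choose a countable set of pairs (x', y') of
    elements of D whose images (r s_n x', r s_n y', r s_n (m x' y')) are dense
    among all such triples, and let s_(n+1) fix x', y' and m x' y' for all
    these pairs, which is possible since m x' y' is in D. Let t be the supremum
    of the s_n, and let x and y be in D. The pairs fixed by r t whose images
    under r s_n approach those of (x, y), for all n, form a filter base. A limit
    (x1, y1) of an ultrafilter finer than this filter satisfies x1 = r t x and
    y1 = r t y, since r s_n x1 = r s_n x for all n, and likewise
    m x1 y1 = r t (m x y). The density of D does the rest. *)
Lemma hom_index_cofinal s0 : (forall x y, D x -> D y -> D (m x y)) ->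
  exists2 t, (s0 <= t)%O & hom_index t.
Proof.
move=> mD.
have ex s : exists t, (s <= t)%O /\ forall x y U V W, D x -> D y ->
    nbhs (r s x) U -> nbhs (r s y) V -> nbhs (r s (m x y)) W ->
    exists x' y', [/\ r t x' = x', r t y' = y', r t (m x' y') = m x' y' &
      [/\ U (r s x'), V (r s y') & W (r s (m x' y'))]].
  have [|C [Cc CD] CP] := @countable_sample _ _ (skeleton_range_base s)
      (L * L)%type (D `*` D) (fun e => r s e.1) (fun e => r s e.2)
      (fun e => r s (m e.1 e.2)).
    by move=> e _; split; [exists e.1|exists e.2|exists (m e.1 e.2)].
  pose C' := (fst @` C) `|` (snd @` C) `|` ((fun e => m e.1 e.2) @` C).
  have [||t st tP] := @D_fix C' s.
  - do ![apply: countable_setU]; apply: sub_countable Cc; exact: card_image_le.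
  - move=> _ [[[e /CD[? ?] <-]//|[e /CD[? ?] <-]//]|[e /CD[? ?] <-]].
    exact: mD.
  exists t; split=> // x y U V W Dx Dy Ux Vy Wm.
  have [[x' y'] Cxy [U' V' W']] := CP (x, y) U V W (conj Dx Dy) Ux Vy Wm.
  exists x', y'; split; [..|by []]; apply: tP.
  - by left; left; exists (x', y').
  - by left; right; exists (x', y').
  - by right; exists (x', y').
have [nx nxP] := choice ex.
pose s := fun n => iter n nx s0.
have sS n : (s n <= s n.+1)%O by have [] := nxP (s n).
have sle := nondecreasing_seq_le sS.
have [t st] := (retractional_complete rS) s sS.
have s_t n : (s n <= t)%O by have [ts _] := st; apply: ts; exists n.
exists t; first exact: (s_t 0%N).
have mtD x y : D x -> D y -> r t (m x y) = m (r t x) (r t y).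
  move=> Dx Dy.
  pose fixed (e : L * L) := [/\ r t e.1 = e.1, r t e.2 = e.2 &
    r t (m e.1 e.2) = m e.1 e.2].
  pose Phi n (e : L * L) := (r (s n) e.1, r (s n) e.2, r (s n) (m e.1 e.2)).
  (* Basic sets: the fixed pairs whose image by Phi n is near that of (x, y). *)
  pose F : set_system (L * L) := filter_from
    [set p : nat * (set (L * L * L)) | nbhs (Phi p.1 (x, y)) p.2]
    (fun p => [set e | fixed e /\ p.2 (Phi p.1 e)]).
  have PF : ProperFilter F.
    apply: filter_from_proper; last first.
      move=> [n V] /= [[U W] /= [[[U1 U2] /= [U1x U2y] U12] Wm] UWV].
      have [_ /(_ x y U1 U2 W Dx Dy U1x U2y Wm)] := nxP (s n).
      move=> [x' [y' [x't y't m't [x's y's m's]]]]; exists (x', y'); split.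
        by split; apply: (skeleton_fix_le rS (s_t n.+1)).
      by apply: UWV; split=> //=; exact: U12.
    apply: filter_from_filter; first by exists (0%N, setT); exact: filterT.
    move=> [n1 V1] [n2 V2] /= V1x V2x; pose n := maxn n1 n2.
    pose h k (p : L * L * L) := (r (s k) p.1.1, r (s k) p.1.2, r (s k) p.2).
    have hc k : continuous (h k).
      move=> p.
      have p1 : z.1 @[z --> p] --> p.1 by exact: cvg_fst.
      have p11 : z.1.1 @[z --> p] --> p.1.1.
        by apply: cvg_comp p1 _; exact: cvg_fst.
      have p12 : z.1.2 @[z --> p] --> p.1.2.
        by apply: cvg_comp p1 _; exact: cvg_snd.
      have p2 : z.2 @[z --> p] --> p.2 by exact: cvg_snd.
      exact: cvg_pair (cvg_pair (r_cvg _ p11) (r_cvg _ p12)) (r_cvg _ p2).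
    have hP k e : (k <= n)%N -> h k (Phi n e) = Phi k e.
      by move=> kn; rewrite /h /Phi/= !(skeleton_le_l rS)//; exact: sle.
    exists (n, h n1 @^-1` V1 `&` h n2 @^-1` V2) => /=.
      by apply: filterI; apply: hc; rewrite hP// ?leq_maxl ?leq_maxr.
    by move=> e [fe [/=]]; rewrite !hP ?leq_maxl ?leq_maxr.
  have [U [UU FU]] := ultraFilterLemma PF.
  have [x1 x1P] := ultra_cvg_compact (fst : L * L -> L) UU Lc.
  have [y1 y1P] := ultra_cvg_compact (snd : L * L -> L) UU Lc.
  have m1P : m e.1 e.2 @[e --> U] --> m x1 y1 by exact: m_cvg.
  have Ufix : \forall e \near U, fixed e.
    by apply: FU; exists (0%N, setT) => [|e []//]; exact: filterT.
  have fixl (u : L * L -> L) l : u e @[e --> U] --> l ->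
      (\forall e \near U, r t (u e) = u e) -> r t l = l.
    move=> ul ut; have : r t (u e) @[e --> U] --> r t l.
      by apply: continuous_cvg ul; exact: rc.
    move=> rul; apply: (hausdorff_cvg_eq _ Lh rul).
    apply: cvg_trans ul; apply: near_eq_cvg.
    by apply: filterS ut => e ->.
  have lims (u : L * L -> L) (l : L) : u e @[e --> U] --> l ->
      (forall n V, nbhs (r (s n) (u (x, y))) V ->
        \forall e \near U, V (r (s n) (u e))) ->
      (\forall e \near U, r t (u e) = u e) -> r t (u (x, y)) = l.
    move=> ul uV /(fixl u l ul) <-; apply: (skeleton_sup_eq Lh rS sS st) => n.
    apply: (hausdorff_cvg_eq (F := U) (u := fun e => r (s n) (u e)) _ Lh).
      by move=> V Vx; exact: uV.
    by apply: continuous_cvg ul; exact: rc.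
  have near_ (n : nat) (q : L * L * L -> L) (V : set L) :
      q z @[z --> Phi n (x, y)] --> q (Phi n (x, y)) ->
      nbhs (q (Phi n (x, y))) V -> \forall e \near U, V (q (Phi n e)).
    by move=> qc Vn; apply: FU; exists (n, q @^-1` V) => [|e []//]; exact: qc.
  rewrite (lims (fun e => m e.1 e.2) _ m1P) ?(lims fst _ x1P)
    ?(lims snd _ y1P)//.
  - move=> n V; apply: (near_ n (fun p => p.1.2)).
    by apply: cvg_comp cvg_fst cvg_snd.
  - by apply: filterS Ufix => e [].
  - move=> n V; apply: (near_ n (fun p => p.1.1)).
    by apply: cvg_comp cvg_fst cvg_fst.
  - by apply: filterS Ufix => e [].
  - by move=> n V; apply: (near_ n snd); exact: cvg_snd.
  - by apply: filterS Ufix => e [].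
move=> x y.
have tailsP := tails_proper (retractional_directed rS).
have xP z : r s z @[s --> @tails _ I] --> z by exact: (retractional_cvg rS).
have rtc u z : u k @[k --> @tails _ I] --> z ->
    r t (u k) @[k --> @tails _ I] --> r t z.
  by move=> uz; apply: continuous_cvg => //; exact: rc.
have h1 : r t (m (r s x) (r s y)) @[s --> @tails _ I] --> r t (m x y).
  by apply: rtc; exact: m_cvg.
apply: (hausdorff_cvg_eq _ Lh h1).
rewrite (_ : (fun s => _) = (fun s => m (r t (r s x)) (r t (r s y)))).
  by apply: m_cvg; apply: rtc.
by apply/funext => u; apply: mtD; exists u.
Qed.

End homomorphic_indices.

(** * Metrizability of compact spaces *)

(** An injective continuous map on a compact space is a homeomorphism onto its
    range. *)
Lemma cvg_injective_compact (S : Type) (T M : topologicalType) (j : T -> M)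
    (F : set_system S) (u : S -> T) (x : T) : Filter F ->
    compact [set: T] -> hausdorff_space M -> continuous j -> injective j ->
  j (u k) @[k --> F] --> j x -> u @ F --> x.
Proof.
move=> FF Tc Mh jc jI jux V /=; rewrite nbhsE => -[B [Bo Bx] BV].
have Cc : closed (j @` (~` B)).
  apply: compact_closed => //; apply: continuous_compact.
    by apply: continuous_subspaceT.
  by apply: (subclosed_compact _ Tc) => //; exact: open_closedC.
have : nbhs (j x) (~` (j @` (~` B))).
  apply: open_nbhs_nbhs; split; first exact: closed_openC.
  by move=> [y By /jI yx]; apply: By; rewrite yx.
move=> Vj; have uV : \forall k \near F, ~ (j @` (~` B)) (j (u k)).
  exact: (jux _ Vj).
suff : \forall k \near F, V (u k) by [].
near=> k; apply: BV; apply: contrapT => nB.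
have : ~ (j @` (~` B)) (j (u k)) by near: k; exact: uV.
by apply; exists (u k).
Unshelve. all: by end_near. Qed.

Section metric_of_dist.
Context {R : realType} {T : choiceType} (d : T -> T -> R).

Record dist_axioms : Prop := DistAxioms {
  distxx : forall x, d x x = 0;
  dist_eq0 : forall x y, d x y = 0 -> x = y;
  dist_sym : forall x y, d x y = d y x;
  dist_triangle : forall y x z, d x z <= d x y + d y z }.

(** A copy of T that carries the metric d, whatever topology T has. *)
Definition metric_of (dA : dist_axioms) : Type := T.

Context (dA : dist_axioms).
Local Notation P := (metric_of dA).

HB.instance Definition _ := Choice.copy P T.
HB.instance Definition _ := @isMetric.Build R P d
  (distxx dA) (dist_eq0 dA) (dist_sym dA) (dist_triangle dA).

Lemma metric_of_ballE (x : P) e : ball x e = [set y | d x y < e].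
Proof. by rewrite ballEmdist. Qed.

End metric_of_dist.

Lemma compact_metrizable (R : realType) (T : topologicalType)
    (d : T -> T -> R) : compact [set: T] -> dist_axioms d ->
  (forall x e, 0 < e -> \forall y \near x, d x y < e) -> metrizable R T.
Proof.
move=> Tc dA dc; exists (metric_of dA), id, id.
have idc : continuous (id : T -> metric_of dA).
  move=> x V /nbhs_ballP[e e0 eV]; apply: filterS eV _.
  by rewrite metric_of_ballE; exact: dc.
split=> // x.
have Mh : hausdorff_space (metric_of dA) := @metric_hausdorff _ (metric_of dA).
by apply: (@cvg_injective_compact _ T (metric_of dA) id
  (nbhs (x : metric_of dA)) id x _ Tc Mh idc) => //; exact: cvg_id.
Qed.

Lemma metrizable_injective (R : realType) (T : topologicalType)
    (M : metricType R) (j : T -> M) :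
  compact [set: T] -> continuous j -> injective j -> metrizable R T.
Proof.
move=> Tc jc jI.
apply: (@compact_metrizable _ _ (fun x y => mdist (j x) (j y))) => //.
  split=> [x|x y /mdist_positivity/jI//|x y|y x z].
  - exact: mdistxx.
  - exact: metric_sym.
  - exact: metric_triangle.
move=> x e e0; have := jc x (ball (j x) e) (nbhsx_ballx _ _ e0).
by rewrite ballEmdist.
Qed.

(** * Restricting a skeleton to some indices and to a fiber *)

Section sub_index.
Context {disp : Order.disp_t} {I : porderType disp} (A : set I).

(** An alias, so that the types of arbitrary sets of indices do not inherit an
    order. *)
Definition sub_index : Type := set_type A.

HB.instance Definition _ := SubChoice.copy sub_index (set_type A).
HB.instance Definition _ :=
  [SubChoice_isSubPOrder of sub_index by <: with disp].

Definition index_val (s : sub_index) : I := val s.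

Lemma index_val_le s t : (index_val s <= index_val t)%O = (s <= t)%O.
Proof. by []. Qed.

Lemma index_valP s : A (index_val s).
Proof. exact: set_valP. Qed.

Definition cofinal := forall s, exists2 t, (s <= t)%O & A t.

Definition sup_closed := forall (s : nat -> I) t,
  (forall n, (s n <= s n.+1)%O) -> supremums (range s) t ->
  (forall n, A (s n)) -> A t.

Lemma sub_index_directed : cofinal -> @up_directed _ I ->
  @up_directed _ sub_index.
Proof.
move=> Acof [[i0 _] dir]; split.
  by have [t _ At] := Acof i0; exists (SigSub (mem_set At)).
move=> s t; have [u [su tu]] := dir (index_val s) (index_val t).
have [v uv Av] := Acof u; exists (SigSub (mem_set Av) : sub_index).
by rewrite -!index_val_le; split; [exact: le_trans uv|exact: le_trans uv].
Qed.

(** A supremum computed in A is a supremum among all indices, because the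
    latter supremum exists and belongs to A. *)
Lemma sub_index_supremum (s : nat -> sub_index) t : @sigma_complete _ I ->
    sup_closed -> (forall n, (s n <= s n.+1)%O) ->
  supremums (range s) t -> supremums (range (index_val \o s)) (index_val t).
Proof.
move=> Isc Asc sS [st ts].
have [u us] := Isc (index_val \o s) sS.
have Au : A u by apply: Asc us _ => // n; exact: index_valP.
have [su us'] := us.
suff -> : index_val t = u by [].
apply/eqP; rewrite eq_le us' ?andbT => [|_ [n _ <-]].
  have /= := ts (SigSub (mem_set Au)); apply => _ [n _ <-].
  by rewrite -index_val_le; apply: su; exists n.
by rewrite index_val_le; apply: st; exists n.
Qed.

Lemma sub_index_complete : @sigma_complete _ I -> sup_closed ->
  @sigma_complete _ sub_index.
Proof.
move=> Isc Asc s sS; have [u us] := Isc (index_val \o s) sS.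
have Au : A u by apply: Asc us _ => // n; exact: index_valP.
have [su us'] := us.
exists (SigSub (mem_set Au)); split=> [_ [n _ <-]|v vs].
  by rewrite -index_val_le; apply: su; exists n.
rewrite -index_val_le; apply: us' => _ [n _ <-].
by rewrite index_val_le; apply: vs; exists n.
Qed.

Lemma sub_index_tails (T : topologicalType) (u : I -> T) (x : T) : cofinal ->
  u @ @tails _ I --> x -> u (index_val s) @[s --> @tails _ sub_index] --> x.
Proof.
move=> Acof ux V /ux [s _ sV]; have [t st At] := Acof s.
exists (SigSub (mem_set At)) => // v /= tv; apply: sV => /=.
by apply: (le_trans st); rewrite -index_val_le in tv.
Qed.

End sub_index.
Arguments index_val {disp I A} s.

Section skeleton_of_fiber.
Context {R : realType} {L G : topologicalType}.
Context (Lc : compact [set: L]) (Lh : hausdorff_space L).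
Context (Gc : compact [set: G]) (e : G -> L) (ec : continuous e).
Context (eI : injective e) (f : L -> R) (fc : continuous f) (c : R).
Context (efc : range e = f @^-1` [set c]).

(** The space G is embedded by e as the fiber of f over c. For large s the
    retraction r s preserves f, hence this fiber, and the restrictions of these
    r s to the fiber form a skeleton. *)
Lemma skeleton_induced_fiber (D : set L) :
  skeleton_induced R D -> skeleton_induced R (e @^-1` D).
Proof.
move=> [disp [I [r [rS DE]]]].
have rc s : continuous (r s) by exact: (retractional_continuous rS).
have [dir sc] := (retractional_directed rS, retractional_complete rS).
have [s0 s0P] := skeleton_factor Lc Lh rS fc.
pose A := [set t | (s0 <= t)%O].
have Acof : cofinal A.
  move=> s; have [_ /(_ s s0)[u [su s0u]]] := dir.
  by exists u.
have Asc : sup_closed A.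
  by move=> s t sS [st _] sA; apply: le_trans (sA 0%N) (st _ _); exists 0%N.
have ex (s : sub_index A) x : exists y, e y = r (index_val s) (e x).
  suff : range e (r (index_val s) (e x)) by move=> [y _ <-]; exists y.
  rewrite efc /= (s0P _ _ (index_valP s)).
  by have : range e (e x) by []; rewrite efc.
have ex2 (s : sub_index A) : exists g : G -> G,
    forall x, e (g x) = r (index_val s) (e x).
  by have [g gP] := choice (ex s); exists g.
have [q qP] := choice ex2.
have qcvg (T : Type) (F : set_system T) (u : T -> G) x : Filter F ->
    e (u k) @[k --> F] --> e x -> u @ F --> x.
  by move=> FF; exact: (cvg_injective_compact FF Gc Lh ec eI).
have qidem s x : q s (q s x) = q s x.
  by apply: eI; rewrite !qP; exact: (retractional_idem rS).
have qc s : continuous (q s).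
  move=> x; apply: qcvg; under eq_fun do rewrite qP; rewrite qP.
  by apply: continuous_cvg; [exact: rc|exact: ec].
exists disp, (sub_index A), q; split.
  split=> //.
  - exact: sub_index_directed.
  - exact: sub_index_complete.
  - move=> s; have [M [g [h [gc hc gh hg]]]] :=
      retractional_metrizable rS (index_val s).
    have er (y : set_type (range (q s))) : range (r (index_val s)) (e (val y)).
      by have [x _ <-] := set_valP y; rewrite qP; exists (e x).
    pose j (y : set_type (range (q s))) : M := g (SigSub (mem_set (er y))).
    apply: (@metrizable_injective _ _ M j).
    + apply/compact_set_type/continuous_compact => //.
      by apply: continuous_subspaceT; exact: qc.
    + pose i y : set_type (range (r (index_val s))) := SigSub (mem_set (er y)).
      have ic : continuous i.
        apply: continuous_to_set_type.
        have evc : continuous (e \o (set_val : set_type (range (q s)) -> G)).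
          move=> y; apply: continuous_comp; last exact: ec.
          exact: continuous_set_val.
        exact: evc.
      by move=> y; apply: (@continuous_comp _ _ _ i g); [exact: ic|exact: gc].
    + move=> y z /(can_inj gh)/(congr1 val)/= /eI; exact: val_inj.
  - move=> x.
    have tailsP := tails_proper (sub_index_directed Acof dir).
    apply: qcvg; under eq_fun do rewrite qP.
    apply: (sub_index_tails (u := fun s => r s (e x))) => //.
    exact: (retractional_cvg rS).
  - move=> s t st; split; apply/funext => x /=; apply: eI; rewrite !qP.
      by rewrite (skeleton_le_l rS).
    by rewrite (skeleton_le_r rS).
  - move=> s t sS st x; apply: qcvg; under eq_fun do rewrite qP; rewrite qP.
    have st' : supremums (range (index_val \o s)) (index_val t).
      by apply: sub_index_supremum st => // n; exact: ltW.
    have h : forall y,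
        r ((index_val \o s) n) y @[n --> \oo] --> r (index_val t) y.
      exact: (retractional_sup rS _ st').
    exact: h.
rewrite eqEsubset; split=> x /=; rewrite DE.
  move=> [s _ [y _ ysx]]; have [_ /(_ s s0)[u [su s0u]]] := dir.
  have Au : A u by [].
  exists (SigSub (mem_set Au) : sub_index A) => //; exists x => //.
  apply: eI; rewrite qP; apply: (skeleton_fix_le rS su).
  by rewrite -ysx; exact: (retractional_idem rS).
by move=> [s _ [y _ <-]]; exists (index_val s) => //; rewrite qP; exists (e y).
Qed.

End skeleton_of_fiber.

(** * Linear functionals and the weak-star topology *)

Section linear_norm.
Context {R : realType} {X Y : normedModType R} (f : X -> Y) (fl : linear f).

Let fL : {linear X -> Y} := HB.pack f (GRing.isLinear.Build _ _ _ _ _ fl).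

Lemma linear_norm_continuous M : (forall x, `|f x| <= M * `|x|) -> continuous f.
Proof.
move=> fM; apply: (@bounded_linear_continuous _ _ _ fL).
apply/linear_boundedP; near=> r => x; rewrite (le_trans (fM x))//.
by rewrite ler_wpM2r.
Unshelve. all: by end_near. Qed.

Lemma linear_bounded_fun_norm M : (forall x, `|f x| <= M * `|x|) ->
  bounded_fun_norm f.
Proof.
move=> fM r; exists (`|M| * r) => x xr; rewrite (le_trans (fM x))//.
by rewrite (le_trans (ler_wpM2r _ (ler_norm M)))// ler_wpM2l.
Qed.

Lemma linear_continuous_bounded_fun_norm : continuous f -> bounded_fun_norm f.
Proof.
move=> fc; apply/(@bounded_funP _ _ _ fL).
by apply: continuous_linear_bounded; exact: fc.
Qed.

(** The boundedness hypothesis is there because the supremum of an unbounded set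
    is 0 by convention. *)
Lemma op_norm_le1P : bounded_fun_norm f ->
  op_norm f <= 1 <-> forall x, `|f x| <= `|x|.
Proof.
have f0 : f 0 = 0 by exact: (raddf0 fL).
have fZ a x : f (a *: x) = a *: f x by exact: (linearZZ fL).
move=> fb; rewrite /op_norm; set S := [set _ | _ in _]; split=> [f1 x|f1].
  have [->|x0] := eqVneq x 0; first by rewrite f0 !normr0.
  have nx0 : 0 < `|x| by rewrite normr_gt0.
  have [M MP] := fb 1.
  have : `|f (`|x|^-1 *: x)| <= 1.
    apply: le_trans f1; apply: ub_le_sup.
      by exists M => _ [y /= y1 <-]; exact: MP.
    exists (`|x|^-1 *: x) => //=.
    by rewrite normrZ normfV normr_id mulVf// gt_eqF.
  rewrite fZ normrZ normfV normr_id.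
  by rewrite ler_pdivrMl// mulr1.
apply: ge_sup; first by exists `|f 0|, 0 => //=; rewrite normr0.
by move=> _ [x /= x1 <-]; exact: le_trans (f1 x) x1.
Qed.

End linear_norm.

Section dual_theory.
Context {R : realType} {X : normedModType R}.
Implicit Types (phi psi : dual X) (x y : X).

Lemma dual_linear phi : linear (phi : X -> R).
Proof. by have /set_mem[] := dual_valP phi. Qed.

Lemma dual_continuous phi : continuous (phi : X -> R).
Proof. by have /set_mem[] := dual_valP phi. Qed.

Lemma dualP phi (a : R) x y : phi (a *: x + y) = a * phi x + phi y.
Proof. exact: dual_linear. Qed.

Lemma dual0 phi : phi 0 = 0.
Proof. by have := dualP phi (-1) 0 0; rewrite scaleN1r addNr mulN1r addNr. Qed.

Lemma dualZ phi (a : R) x : phi (a *: x) = a * phi x.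
Proof. by rewrite -[a *: x]addr0 dualP dual0 addr0. Qed.

Lemma dualD phi x y : phi (x + y) = phi x + phi y.
Proof. by rewrite -[x]scale1r dualP scale1r mul1r. Qed.

Lemma dualN phi x : phi (- x) = - phi x.
Proof. by rewrite -scaleN1r dualZ mulN1r. Qed.

Lemma dualB phi x y : phi (x - y) = phi x - phi y.
Proof. by rewrite dualD dualN. Qed.

Lemma dual_addE phi psi x : (phi + psi) x = phi x + psi x.
Proof. by []. Qed.

Lemma dual_scaleE (a : R) phi x : (a *: phi) x = a * phi x.
Proof. by []. Qed.

Lemma dual_oppE phi x : (- phi) x = - phi x.
Proof. by []. Qed.

Lemma dual_eq phi psi : (forall x, phi x = psi x) -> phi = psi.
Proof. by move=> H; apply/val_inj/funext. Qed.

Definition mk_dual (f : X -> R) (fl : linear f) (M : R)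
  (fM : forall x, `|f x| <= M * `|x|) : dual X :=
  Dual (mem_set (conj fl (linear_norm_continuous fl fM))).

Lemma dual_ballP phi : dual_ball X phi <-> forall x, `|phi x| <= `|x|.
Proof.
apply: op_norm_le1P; first exact: dual_linear.
apply: linear_continuous_bounded_fun_norm; first exact: dual_linear.
exact: dual_continuous.
Qed.

Lemma dual_ball_exists (f : X -> R) : linear f -> (forall x, `|f x| <= `|x|) ->
  exists2 phi : dual X, dual_ball X phi & forall x, phi x = f x.
Proof.
move=> fl f1.
have fM x : `|f x| <= 1 * `|x| by rewrite mul1r.
by exists (mk_dual fl fM) => //; apply/dual_ballP.
Qed.

Lemma weak_star_cvg (T : Type) (F : set_system T) (u : T -> weak_star X)
    (phi : weak_star X) : Filter F ->
  (forall x, (u k : dual X) x @[k --> F] --> (phi : dual X) x) -> u @ F --> phi.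
Proof.
move=> FF ux.
apply: (@cvg_initial _ _ (fun phi : dual X => (phi : {ptws X -> R}))).
by apply/pointwise_cvgP => x; exact: ux.
Qed.

Lemma weak_star_eval_continuous x :
  continuous (fun phi : weak_star X => (phi : dual X) x).
Proof.
move=> phi.
have h := @initial_continuous _ _
  (fun phi : dual X => (phi : {ptws X -> R})) phi.
have FF : Filter (nbhs (phi : weak_star X)) by exact: nbhs_filter.
have /(_ x) hx := (pointwise_cvgP (dual_val phi) (fmap_filter _ FF)).1 h.
exact: hx.
Qed.

Lemma weak_star_hausdorff : hausdorff_space (weak_star X).
Proof.
move=> phi psi pp; apply: dual_eq => x; apply: (@Rhausdorff R) => U V Ux Vx.
have [||z [Uz Vz]] :=
  pp (fun z => U ((z : dual X) x)) (fun z => V ((z : dual X) x)).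
- exact: weak_star_eval_continuous.
- exact: weak_star_eval_continuous.
by exists ((z : dual X) x).
Qed.

(** Banach-Alaoglu: along an ultrafilter of functionals of the ball, the values
    at each x converge, by the compactness of a segment, and the pointwise limit
    is again a functional of the ball. *)
Lemma dual_ball_compact : compact (dual_ball X).
Proof.
rewrite compact_ultra => F UF FB.
have ex x : exists l : R, (phi : dual X) x @[phi --> F] --> l.
  have sc : compact `[- `|x|, `|x|]%classic by exact: segment_compact.
  have [|l _ lP] := ultra_cvg_compact_set
    (u := fun phi : weak_star X => (phi : dual X) x) UF sc; last by exists l.
  apply: filterS FB => phi /dual_ballP/(_ x).
  by rewrite ler_norml /= in_itv.
have [g gP] := choice ex.
have gl : linear g.
  move=> a x y.
  have h : (phi : dual X) (a *: x + y) @[phi --> F] --> a * g x + g y.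
    under eq_fun do rewrite dualP.
    by apply: cvgD; [apply: cvgM; [exact: cvg_cst|exact: gP]|exact: gP].
  by apply: (hausdorff_cvg_eq _ _ (gP (a *: x + y)) h); exact: Rhausdorff.
have g1 x : `|g x| <= `|x|.
  have h : `|(phi : dual X) x| @[phi --> F] --> `|g x|.
    by apply: cvg_norm; exact: gP.
  have near_le : \forall phi \near F,
      [set y : R | y <= `|x|] `|(phi : dual X) x|.
    by apply: filterS FB => phi /dual_ballP/(_ x).
  exact: (closed_cvg _ (@closed_le R `|x|) near_le _ h).
have [phi phi1 phig] := dual_ball_exists gl g1.
exists phi; split=> //.
by apply: (@weak_star_cvg _ F id phi) => x; rewrite phig; exact: gP.
Qed.

End dual_theory.

(** * From projections on a space to retractions of its dual ball *)

Lemma convex_setP (R : realType) (V : lmodType R) (A : set V) :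
  convex_set A <-> (forall x y (a : R), A x -> A y -> 0 <= a -> a <= 1 ->
    A (a *: x + (1 - a) *: y)).
Proof.
split=> [cA x y a Ax Ay a0 a1|cA x y a /set_mem Ax /set_mem Ay].
  by have /set_mem := cA x y (Itv01 a0 a1) (mem_set Ax) (mem_set Ay).
by apply: mem_set; exact: cA.
Qed.

Section dual_skeleton.
Context {R : realType} {X : completeNormedModType R}.
Context {disp : Order.disp_t} {I : porderType disp} {P : I -> X -> X}.
Context (PS : projectional_skeleton P) (P1 : forall s, op_norm (P s) <= 1).

Let Pl s : linear (P s). Proof. exact: (projectional_linear PS). Qed.

Let PB s x y : P s (x - y) = P s x - P s y.
Proof. by rewrite addrC -scaleN1r Pl scaleN1r addrC. Qed.

Let P_contract s x : `|P s x| <= `|x|.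
Proof.
exact: (op_norm_le1P (@Pl s) (projectional_bounded PS s)).1.
Qed.

Let P_le_l s t x : (s <= t)%O -> P s (P t x) = P s x.
Proof. by move=> /(projectional_comp PS)[/(congr1 (fun g => g x)) /= <- _]. Qed.

Let P_le_r s t x : (s <= t)%O -> P t (P s x) = P s x.
Proof. by move=> /(projectional_comp PS)[_ /(congr1 (fun g => g x)) /= <-]. Qed.

Let P_cover x : exists s, forall t, (s <= t)%O -> P t x = x.
Proof.
have : [set: X] x by [].
rewrite (projectional_cover PS) => -[s _ [y _ <-]].
by exists s => t st; rewrite P_le_r.
Qed.

(** The vector P t x is a limit of vectors fixed by P (s n) for large n, and
    the projections do not increase distances. *)
Let P_sup (s : nat -> I) t x : (forall n, (s n < s n.+1)%O) ->
  supremums (range s) t -> P (s n) x @[n --> \oo] --> P t x.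
Proof.
move=> sS st; apply/cvgrPdist_lt => e e0.
have e20 : 0 < e / 2 by rewrite divr_gt0.
have sle := nondecreasing_seq_le (fun n => ltW (sS n)).
have slt n : (s n <= t)%O by have [st' _] := st; apply: st'; exists n.
have : closure (\bigcup_n range (P (s n))) (P t x).
  by rewrite -(projectional_sup PS sS st); exists x.
move=> /(_ _ (nbhsx_ballx _ _ e20))[z [[m _ [w _ wz]]]].
rewrite -ball_normE /= => xz.
exists m => // n /= mn; have zn : P (s n) z = z by rewrite -wz P_le_r// sle.
rewrite -(subrKA z) (splitr e) (le_lt_trans (ler_normD _ _))// ltrD//.
rewrite -[in ltLHS]zn -(P_le_l x (slt n)) -PB.
by rewrite (le_lt_trans (P_contract _ _))// distrC.
Qed.

Local Notation B := (set_type (dual_ball X)).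

Let ev (b : B) : dual X := set_val b.

Let ev_inj (b c : B) : (forall x, ev b x = ev c x) -> b = c.
Proof. by move=> bc; apply/val_inj/dual_eq. Qed.

Let ev_cvg (T : Type) (F : set_system T) (u : T -> B) (b : B) : Filter F ->
  (forall x, ev (u k) x @[k --> F] --> ev b x) -> u @ F --> b.
Proof. by move=> FF ux; apply: cvg_set_type; apply: weak_star_cvg. Qed.

Let ev_continuous x : continuous (fun b : B => ev b x).
Proof.
move=> b; apply: (@continuous_comp _ _ _ set_val
  (fun phi : weak_star X => (phi : dual X) x)).
  exact: continuous_set_val.
exact: weak_star_eval_continuous.
Qed.

Let ev_le (b : B) x : `|ev b x| <= `|x|.
Proof. by have /dual_ballP := set_valP b; exact. Qed.

Let adjoint : exists r : I -> B -> B, forall s b x, ev (r s b) x = ev b (P s x).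
Proof.
have ex s (b : B) : exists c : B, forall x, ev c x = ev b (P s x).
  have [||phi phi1 phiE] := @dual_ball_exists _ _ (fun x => ev b (P s x)).
  - by move=> a x y; rewrite Pl dualP.
  - by move=> x; rewrite (le_trans (ev_le _ _))// P_contract.
  - by exists (SigSub (mem_set phi1)).
have ex2 s : exists g : B -> B, forall b x, ev (g b) x = ev b (P s x).
  by have [g gP] := choice (ex s); exists g.
by have [r rP] := choice ex2; exists r.
Qed.

(** A dense sequence of the range of P s separates the functionals that factor
    through P s. *)
Let dense_seq s : exists y : nat -> X,
  forall phi psi : dual X, (forall n, phi (y n) = psi (y n)) ->
    forall x, phi (P s x) = psi (P s x).
Proof.
have [D Dc Dd] := projectional_separable PS s.
have D0 : D !=set0.
  have P0 : range (P s) (P s 0) by exists 0.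
  pose z : set_type (range (P s)) := SigSub (mem_set P0).
  by have [||w [_ Dw]] := Dd setT; [exists z|exact: openT|exists w].
have [|[e]] := pfcard_geP Dc; first by move=> DE; move: D0; rewrite DE => -[].
exists (fun n => set_val (e n)) => phi psi pp x.
apply: contrapT => /eqP neq.
have c (chi : dual X) :
    continuous (chi \o (set_val : set_type (range (P s)) -> X)).
  move=> z; apply: continuous_comp; first exact: continuous_set_val.
  exact: dual_continuous.
pose f (z : set_type (range (P s))) := phi (set_val z) - psi (set_val z).
have fc : continuous f by move=> z; exact: cvgB (c phi z) (c psi z).
have [||z [/= fz Dz]] := Dd (f @^-1` (~` [set 0])).
- have Px : range (P s) (P s x) by exists x.
  exists (SigSub (mem_set Px)) => /=.
  by apply/eqP; rewrite subr_eq0.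
- move/continuousP : fc; apply; apply: closed_openC; exact: closed_eq.
have [n _ nz] := 'surj_e Dz; apply: fz.
by apply/eqP; rewrite subr_eq0 -nz pp.
Qed.

(** The seminorms phi |-> |phi (y n)| separate the points of the range of r s.
    Rescaled so that |z n| <= 1 / (n + 1), the vectors z n give a supremum
    distance d that is weak-star continuous on the ball: near a given point the
    finitely many large z n are controlled by the topology, the others by their
    norm. *)
Let range_metrizable (r : I -> B -> B) s :
    (forall s b x, ev (r s b) x = ev b (P s x)) -> continuous (r s) ->
  metrizable R (set_type (range (r s))).
Proof.
move=> rP rc; pose T := set_type (range (r s)).
pose e (b : T) : dual X := ev (set_val b).
have eP (b : T) x : e b (P s x) = e b x.
  rewrite /e; have [c _ cb] := set_valP b.
  have -> : set_val b = r s c by exact: esym cb.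
  by rewrite !rP (projectional_idem PS).
have e_inj (b c : T) : (forall x, e b x = e c x) -> b = c.
  by move=> bc; apply/val_inj/ev_inj.
have ec x : continuous (fun b : T => e b x).
  move=> b; apply: (@continuous_comp _ _ _ (set_val : T -> B)
    (fun b : B => ev b x)).
    exact: continuous_set_val.
  exact: ev_continuous.
have [y yP] := dense_seq s.
(* The summand 1 prevents a division by zero when y n = 0. *)
pose a n : R := (n.+1%:R * (1 + `|y n|))^-1.
have a0 n : 0 < a n by rewrite invr_gt0 mulr_gt0// ltr_pwDl.
pose z n := a n *: y n.
have zn n : `|z n| <= n.+1%:R^-1.
  rewrite /z normrZ gtr0_norm// /a invfM -mulrA ler_piMr//.
  by rewrite mulrC ler_pdivrMr ?ltr_pwDl// mul1r lerDr.
pose g (b c : T) n := `|e b (z n) - e c (z n)|.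
have g_le b c n : g b c n <= 2 * n.+1%:R^-1.
  rewrite /g (le_trans (ler_normB _ _))// mulr_natl mulr2n.
  by rewrite lerD// (le_trans (ev_le _ _)).
have g_ub b c : has_ubound (range (g b c)).
  exists 2 => _ [n _ <-]; rewrite (le_trans (g_le b c n))//.
  by rewrite ler_piMr// invf_le1// ler1n.
pose d (b c : T) : R := sup (range (g b c)).
have gd b c n : g b c n <= d b c by apply: ub_le_sup => //; exists n.
have d_le b c (M : R) : (forall n, g b c n <= M) -> d b c <= M.
  move=> gM; apply: ge_sup; first by exists (g b c 0), 0.
  by move=> _ [n _ <-].
apply: (@compact_metrizable _ _ d).
- apply/compact_set_type/continuous_compact.
    by apply: continuous_subspaceT; exact: rc.
  by apply: compact_set_type; exact: dual_ball_compact.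
- split.
  + move=> b; apply/eqP; rewrite eq_le; apply/andP; split.
      by apply: d_le => n; rewrite /g subrr normr0.
    by apply: le_trans (gd b b 0); rewrite /g normr_ge0.
  + move=> b c bc0; apply: e_inj => x; rewrite -eP -[in RHS]eP.
    apply: yP => n; apply/eqP; rewrite -subr_eq0 -normr_eq0.
    have : g b c n <= 0 by rewrite -bc0.
    rewrite /g /z !dualZ -mulrBr normrM gtr0_norm// pmulr_rle0//.
    by rewrite normr_le0 normr_eq0.
  + move=> b c; rewrite /d (_ : g b c = g c b)//.
    by apply/funext => n; exact: distrC.
  + move=> c b h; apply: d_le => n; rewrite /g -(subrKA (e c (z n))).
    exact: (le_trans (ler_normD _ _) (lerD (gd b c n) (gd c h n))).
move=> b eps eps0.
have e20 : 0 < eps / 2 / 2 by rewrite !divr_gt0.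
have [N Ne] := ltr_add_invr e20; rewrite add0r in Ne.
have : \forall c \near b, forall n : 'I_N, g b c n < eps / 2.
  apply: (@filter_forall _ _ _ _ (nbhs_filter b)) => n.
  have /cvgrPdist_lt H : e c (z n) @[c --> b] --> e b (z n) by exact: ec.
  by apply: H; rewrite divr_gt0.
apply: filterS => c cP.
rewrite (@le_lt_trans _ _ (eps / 2)) ?ltr_pdivrMr ?ltr_pMr ?ltr1n//.
apply: d_le => n; have [nN|Nn] := ltnP n N.
  by apply/ltW; exact: (cP (Ordinal nN)).
rewrite (le_trans (g_le b c n))// mulrC -ler_pdivlMr//.
rewrite (le_trans _ (ltW Ne))// lef_pV2 ?posrE// ler_nat.
by rewrite ltnS.
Qed.

(** The induced set consists of the functionals of the ball that are fixed by
    some adjoint; it is convex because two indices have an upper bound. *)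
Lemma dual_ball_skeleton : exists D : set B,
  [/\ skeleton_induced R D, convex_set (in_dual D) & symmetric_set (in_dual D)].
Proof.
have [dir sc] := (projectional_directed PS, projectional_complete PS).
have tailsP := tails_proper dir.
have Bc : compact [set: B] by apply: compact_set_type; exact: dual_ball_compact.
have [r rP] := adjoint.
have rc s : continuous (r s).
  move=> b; apply: (ev_cvg (nbhs_filter _)) => x; rewrite rP.
  under eq_fun do rewrite rP.
  exact: ev_continuous.
have rE s (phi : dual X) : in_dual (range (r s)) phi <->
    dual_ball X phi /\ forall x, phi (P s x) = phi x.
  split=> [[_ [b _ <-] <-]|[phi1 phiP]].
    split; first exact: (set_valP (r s b)).
    move=> x; have := rP s b; rewrite /ev => rP'; rewrite !rP'.
    by rewrite (projectional_idem PS).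
  exists (SigSub (mem_set phi1)) => //; exists (SigSub (mem_set phi1)) => //.
  by apply: ev_inj => x; rewrite rP /ev/= phiP.
pose D := \bigcup_s range (r s).
have DE (phi : dual X) : in_dual D phi <->
    dual_ball X phi /\ exists s, forall x, phi (P s x) = phi x.
  split=> [[b [s _ rb] bphi]|[phi1 [s phis]]].
    have rbphi : in_dual (range (r s)) phi by exists b.
    by have [? ?] := (rE s phi).1 rbphi; split=> //; exists s.
  have [b rb bphi] := (rE s phi).2 (conj phi1 phis).
  by exists b => //; exists s.
exists D; split.
- exists disp, I, r; split=> //; split=> //.
  + by move=> s b; apply: ev_inj => x; rewrite !rP (projectional_idem PS).
  + by move=> s; exact: range_metrizable.
  + move=> b; apply: ev_cvg => x; have [s sP] := P_cover x.
    apply: cvg_near_cst; exists s => // t /= st.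
    by rewrite rP sP.
  + move=> s t st; split; apply/funext => b /=; apply: ev_inj => x; rewrite !rP.
      by rewrite P_le_r.
    by rewrite P_le_l.
  + move=> s t sS st b; apply: ev_cvg => x; rewrite rP.
    under eq_fun do rewrite rP.
    apply: continuous_cvg; first exact: dual_continuous.
    exact: P_sup.
- apply/convex_setP => phi psi a /DE[phi1 [s phis]] /DE[psi1 [t psit]] a0 a1.
  apply/DE; split.
    apply/dual_ballP => x; rewrite dual_addE !dual_scaleE.
    rewrite (le_trans (ler_normD _ _))// !normrM (ger0_norm a0).
    rewrite (ger0_norm (x := 1 - a)) ?subr_ge0//.
    rewrite (_ : `|x| = a * `|x| + (1 - a) * `|x|); last first.
      by rewrite -mulrDl addrC subrK mul1r.
    move/dual_ballP : phi1 => phi1; move/dual_ballP : psi1 => psi1.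
    by rewrite lerD// ler_wpM2l// subr_ge0.
  have [_ /(_ s t)[u [su tu]]] := dir; exists u => x.
  rewrite !dual_addE !dual_scaleE.
  rewrite -(phis (P u x)) -(psit (P u x)) !P_le_l//.
  by rewrite phis psit.
- move=> phi /DE[phi1 [s phis]]; apply/DE; split.
    apply/dual_ballP => x; rewrite dual_oppE normrN.
    by move/dual_ballP : phi1; exact.
  by exists s => x; rewrite !dual_oppE phis.
Qed.

End dual_skeleton.

(** * Finite covers and finite convex combinations *)

Lemma compact_finite_cover (T : topologicalType) (V : T -> set T) :
  compact [set: T] -> (forall x, nbhs x (V x)) ->
  exists s : seq T, forall y, exists2 x, List.In x s & V x y.
Proof.
move=> /compact_near_coveringP Tc Vx.
pose F : set_system (seq T) := filter_from [set: seq T]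
  (fun s => [set t | forall x, List.In x s -> List.In x t]).
have FF : ProperFilter F.
  apply: filter_from_proper; last by move=> s _; exists s.
  apply: filter_from_filter; first by exists [::].
  move=> s t _ _; exists (s ++ t)%list => // u /= stu.
  by split=> x xs; apply: stu; apply/List.in_or_app; [left|right].
have [|s _ sP] := Tc _ F (fun s y => exists2 x, List.In x s & V x y) _.
  move=> x _; exists (V x, [set t | List.In x t]).
    by split; [exact: Vx|exists [:: x] => // t /=; apply; left].
  by move=> [y t] /= [Vxy xt]; exists x.
exists s => y; exact: (sP s).
Qed.

(** If Z missed t, its last point before t and its first point after t would
    have a midpoint in Z, strictly between them. *)
Lemma midpoint_closed_itv (R : realType) (Z : set R) : closed Z ->
  Z 0 -> Z 1 ->
  (forall a b, 0 <= a -> a <= b -> b <= 1 -> Z a -> Z b -> Z ((a + b) / 2)) ->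
  forall t, 0 <= t -> t <= 1 -> Z t.
Proof.
move=> Zc Z0 Z1 Zm t t0 t1; apply: contrapT => nZt.
pose A := Z `&` [set a | a <= t]; pose B := Z `&` [set b | t <= b].
have Asup : has_sup A by split; [exists 0|exists t => a []].
have Binf : has_inf B by split; [exists 1|exists t => b []].
have [ZA At] : A (sup A).
  have : closed A by apply: closedI => //; exact: closed_le.
  move=> /closure_id Ac; rewrite {1}Ac; apply: closure_sup; first by exists 0.
  by exists t => a [].
have [ZB tB] : B (inf B).
  have : closed B by apply: closedI => //; exact: closed_ge.
  move=> /closure_id Bc; rewrite {1}Bc => U /nbhs_ballP[e e0 eU].
  have [b Bb be] := inf_adherent e0 Binf; exists b; split=> //; apply: eU.
  rewrite -ball_normE /= distrC ger0_norm ?ltrBlDl// subr_ge0.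
  by apply: ge_inf => //; case: Binf.
have A_lt : sup A < t.
  by rewrite lt_neqAle At andbT; apply/eqP => At'; apply: nZt; rewrite -At'.
have B_gt : t < inf B.
  by rewrite lt_neqAle tB andbT; apply/eqP => At'; apply: nZt; rewrite At'.
have AB : sup A < inf B by exact: lt_trans B_gt.
have A0 : 0 <= sup A by apply: ub_le_sup; [case: Asup|split].
have B1 : inf B <= 1 by apply: ge_inf; [case: Binf|split].
have Zmid := Zm _ _ A0 (ltW AB) B1 ZA ZB.
have [mt|tm] := leP ((sup A + inf B) / 2) t.
  have : (sup A + inf B) / 2 <= sup A by apply: ub_le_sup; [case: Asup|split].
  by rewrite leNgt midf_lt.
have : inf B <= (sup A + inf B) / 2.
  by apply: ge_inf; [case: Binf|split=> //; exact: ltW].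
by rewrite leNgt midf_lt.
Qed.

Section finite_convex_combination.
Context {R : realType} {V : lmodType R} (A : set V).
Context (Acvx : forall x y (a : R), A x -> A y -> 0 <= a -> a <= 1 ->
    A (a *: x + (1 - a) *: y)).

Lemma convex_comb_seq (T : Type) (s : seq T) (w : T -> R) (v : T -> V) :
    (forall x, 0 <= w x) -> (forall x, A (v x)) -> 0 < \sum_(x <- s) w x ->
  A ((\sum_(x <- s) w x)^-1 *: \sum_(x <- s) w x *: v x).
Proof.
move=> w0 Av; elim: s => [|x s ih]; first by rewrite big_nil ltxx.
rewrite !big_cons; set c := \sum_(_ <- s) w _; set y := \sum_(_ <- s) _ *: _.
have c0 : 0 <= c by rewrite sumr_ge0.
have [c_eq0|c_neq0] := eqVneq c 0.
  rewrite c_eq0 addr0 => wx0.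
  have -> : y = 0.
    have : all (fun x => w x == 0) s.
      have := c_eq0; rewrite /c; elim: (s) => //= z t iht.
      rewrite big_cons => /eqP.
      by rewrite paddr_eq0 ?sumr_ge0// => /andP[-> /eqP/iht].
    rewrite /y; elim: (s) => [|z t iht] /=; first by rewrite big_nil.
    by rewrite big_cons => /andP[/eqP -> /iht ->]; rewrite scale0r addr0.
  by rewrite addr0 scalerA mulVf ?scale1r// gt_eqF.
have {}c_gt0 : 0 < c by rewrite lt_neqAle eq_sym c_neq0.
move=> wxc; have Ay := ih c_gt0.
have := Acvx (a := w x / (w x + c)) (Av x) Ay.
have -> : 1 - w x / (w x + c) = c / (w x + c).
  by rewrite -[X in X - _](divff (lt0r_neq0 wxc)) -mulrBl addrAC subrr add0r.
rewrite scalerDr !scalerA mulrC [_ * c^-1]mulrAC divff// mul1r; apply.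
  by rewrite mulr_ge0// ?invr_ge0 ?(ltW wxc).
by rewrite mulrC ler_pdivrMr// mul1r lerDl.
Qed.

End finite_convex_combination.

(** * States, that is, probability measures as functionals *)

Section states.
Context {R : realType} {K : topologicalType} (Kc : compact [set: K]).
Local Notation C := (cfun R Kc).
Local Notation "f `[ x ]" := (cfun_val f x) (at level 2, format "f `[ x ]").
Implicit Types (f g : C) (phi psi : dual C).

Definition mk_cfun (f : K -> R) (fc : continuous f) : C :=
  cfun_Sub Kc (mem_set fc).

Lemma mk_cfunE (f : K -> R) (fc : continuous f) x : (mk_cfun fc)`[x] = f x.
Proof. by []. Qed.

Lemma cfun_eq f g : (forall x, f`[x] = g`[x]) -> f = g.
Proof. by move=> fg; apply/val_inj/funext. Qed.

Lemma cfun_continuous f : continuous (cfun_val f).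
Proof. exact: cts_fun. Qed.

Lemma cfunD f g x : (f + g)`[x] = f`[x] + g`[x]. Proof. by []. Qed.
Lemma cfunN f x : (- f)`[x] = - f`[x]. Proof. by []. Qed.
Lemma cfunZ (a : R) f x : (a *: f)`[x] = a * f`[x]. Proof. by []. Qed.

Lemma cfun_sum (T : Type) (s : seq T) (F : T -> C) x :
  (\sum_(i <- s) F i)`[x] = \sum_(i <- s) (F i)`[x].
Proof. by elim/big_rec2: _ => // i y1 y2 _ <-. Qed.

Lemma cfun_norm_le f (M : R) : 0 <= M -> (forall x, `|f`[x]| <= M) -> `|f| <= M.
Proof. exact: sup_norm_le. Qed.

Lemma cfun_le_norm f x : `|f`[x]| <= `|f|.
Proof. exact: sup_norm_ub. Qed.

Definition cfun_one : C := mk_cfun (@cst_continuous K R 1).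

(** These are the functionals represented by Radon probability measures, when K
    is Hausdorff; positivity follows from the two conditions. *)
Definition states : set (weak_star C) :=
  [set phi : dual C | dual_ball C phi /\ phi cfun_one = 1].

Lemma states_compact : compact states.
Proof.
have -> : states =
    dual_ball C `&` [set phi : weak_star C | (phi : dual C) cfun_one = 1].
  by [].
apply: compact_closedI; first exact: dual_ball_compact.
have /continuous_closedP ec := @weak_star_eval_continuous R C cfun_one.
exact: (ec [set 1] (@closed_eq R 1)).
Qed.

(** If f >= 0, then f is within |f| of the constant |f|, so that
    |f| - phi f <= |f|. *)
Lemma state_ge0 phi f : states phi -> (forall x, 0 <= f`[x]) -> 0 <= phi f.
Proof.
move=> [/dual_ballP phi1 phi_one] f0.
have : `|(`|f| : R) *: cfun_one - f| <= `|f|.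
  apply: cfun_norm_le => // x; rewrite cfunD cfunN cfunZ mulr1.
  have := cfun_le_norm f x; rewrite (ger0_norm (f0 x)) => fx.
  by rewrite ger0_norm ?subr_ge0// gerBl.
have := phi1 ((`|f| : R) *: cfun_one - f).
move=> h1 h2; have := le_trans (le_trans (ler_norm _) h1) h2.
by rewrite dualB dualZ phi_one mulr1 gerBl.
Qed.

Lemma state_le phi f g : states phi -> (forall x, f`[x] <= g`[x]) ->
  phi f <= phi g.
Proof.
move=> phiS fg; rewrite -subr_ge0 -dualB; apply: state_ge0 => // x.
by rewrite cfunD cfunN subr_ge0.
Qed.

Lemma state_dist phi f g (e : R) : states phi ->
  (forall x, `|f`[x] - g`[x]| <= e) -> `|phi f - phi g| <= e.
Proof.
move=> phiS fge.
have [K0|K0] := pselect ([set: K] !=set0); last first.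
  have -> : f = g by apply: cfun_eq => x; exfalso; apply: K0; exists x.
  have [_] := phiS; suff -> : cfun_one = 0.
    by rewrite dual0 => /esym/eqP; rewrite oner_eq0.
  by apply: cfun_eq => x; exfalso; apply: K0; exists x.
have [x0 _] := K0.
have e0 : 0 <= e by exact: le_trans (fge x0).
rewrite -dualB; have [/dual_ballP phi1 _] := phiS.
by rewrite (le_trans (phi1 _))//; apply: cfun_norm_le.
Qed.

Lemma state_convex phi psi (a : R) : states phi -> states psi ->
  0 <= a -> a <= 1 -> states (a *: phi + (1 - a) *: psi).
Proof.
move=> [/dual_ballP phi1 phi_one] [/dual_ballP psi1 psi_one] a0 a1; split.
  apply/dual_ballP => f; rewrite dual_addE !dual_scaleE.
  rewrite (le_trans (ler_normD _ _))// !normrM (ger0_norm a0).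
  rewrite (ger0_norm (x := 1 - a)) ?subr_ge0//.
  rewrite [leRHS](_ : _ = a * `|f| + (1 - a) * `|f|); last first.
    by rewrite -mulrDl addrC subrK mul1r.
  by rewrite lerD// ler_wpM2l// subr_ge0.
by rewrite dual_addE !dual_scaleE phi_one psi_one !mulr1 addrC subrK.
Qed.

Lemma dirac_exists : exists d : K -> dual C,
  forall x, states (d x) /\ forall f, d x f = f`[x].
Proof.
have ex x : exists phi : dual C, states phi /\ forall f, phi f = f`[x].
  have [||phi phi1 phiE] := @dual_ball_exists _ C (fun f => f`[x]).
  - by [].
  - by move=> f; exact: cfun_le_norm.
  by exists phi; split=> //; split=> //; rewrite phiE.
by have [d dP] := choice ex; exists d.
Qed.

Definition dirac_state : K -> set_type states :=
  fun x => SigSub (mem_set ((projT2 (cid dirac_exists)) x).1).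

Definition state_ev (mu : set_type states) : dual C := set_val mu.

Lemma state_evP mu : states (state_ev mu).
Proof. exact: set_valP. Qed.

Lemma dirac_stateE x f : state_ev (dirac_state x) f = f`[x].
Proof. by have [_] := (projT2 (cid dirac_exists)) x; exact. Qed.

Lemma state_ev_inj mu nu : (forall f, state_ev mu f = state_ev nu f) -> mu = nu.
Proof. by move=> mn; apply/val_inj/dual_eq. Qed.

Lemma state_ev_cvg (T : Type) (F : set_system T) (u : T -> set_type states)
    (mu : set_type states) : Filter F ->
  (forall f, state_ev (u k) f @[k --> F] --> state_ev mu f) -> u @ F --> mu.
Proof. by move=> FF ux; apply: cvg_set_type; apply: weak_star_cvg. Qed.

Lemma state_ev_continuous f : continuous (fun mu => state_ev mu f).
Proof.
move=> mu; apply: (@continuous_comp _ _ _ set_val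
  (fun phi : weak_star C => (phi : dual C) f)).
  exact: continuous_set_val.
exact: weak_star_eval_continuous.
Qed.

Lemma cvg_state_ev (T : Type) (F : set_system T) (u : T -> set_type states)
    (mu : set_type states) f : Filter F ->
  u @ F --> mu -> state_ev (u k) f @[k --> F] --> state_ev mu f.
Proof.
move=> FF um.
exact: (cvg_comp u (fun mu => state_ev mu f) um (@state_ev_continuous f mu)).
Qed.

Lemma dirac_state_continuous : continuous dirac_state.
Proof.
move=> x; apply: (state_ev_cvg (nbhs_filter _)) => f; rewrite dirac_stateE.
by under eq_fun do rewrite dirac_stateE; exact: cfun_continuous.
Qed.

(** States are approximated by convex combinations of Dirac measures on finitely
    many functions: take a finite partition of unity p_x such that every f of
    the list varies by at most e on the support of p_x, and give the Dirac
    measure at x the weight phi (p_x). *)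
Lemma state_dirac_approx phi (fs : seq C) (e : R) (A : set (dual C)) :
    states phi -> 0 < e -> (forall x, A (state_ev (dirac_state x))) ->
    (forall phi psi (a : R), A phi -> A psi -> 0 <= a -> a <= 1 ->
      A (a *: phi + (1 - a) *: psi)) ->
  exists2 psi, A psi & forall f, List.In f fs -> `|phi f - psi f| <= e.
Proof.
move=> phiS e0 Ad Acvx.
(* D is the pseudometric attached to fs; h x is positive on its e-ball at x. *)
pose D x y : R := \big[Order.max/0]_(f <- fs) `|f`[x] - f`[y]|.
have D_le x y f : List.In f fs -> `|f`[x] - f`[y]| <= D x y.
  rewrite /D; elim: (fs) => //= g gs ih.
  rewrite big_cons le_max => -[->|/ih ->].
    by rewrite lexx.
  by rewrite orbT.
have Dxx x : D x x = 0.
  rewrite /D; elim: (fs) => [|g gs ih]; first by rewrite big_nil.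
  by rewrite big_cons ih subrr normr0 maxxx.
have Dc x : continuous (D x).
  rewrite /D; elim: (fs) => [|g gs ih] y.
    by under eq_fun do rewrite big_nil; exact: cst_continuous.
  under eq_fun do rewrite big_cons.
  apply: (@continuous_max _ _ (fun y => `|g`[x] - g`[y]|)); last exact: ih.
  apply: cvg_norm; apply: cvgB; first exact: cvg_cst.
  exact: cfun_continuous.
pose h x y : R := Order.max 0 (e - D x y).
have hc x : continuous (h x).
  move=> y; apply: (@continuous_max _ _ (cst 0) (fun y => e - D x y) y).
    exact: cst_continuous.
  by apply: cvgB; [exact: cvg_cst|exact: Dc].
have h0 x y : 0 <= h x y by rewrite le_max lexx.
have hxx x : 0 < h x x by rewrite lt_max Dxx subr0 e0 orbT.
have hD x y : 0 < h x y -> D x y < e.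
  by rewrite lt_max ltxx /= subr_gt0.
have [s sP] := @compact_finite_cover K (fun x => [set y | 0 < h x y]) Kc
  (fun x => cvgr_gt _ (hc x x) _ (hxx x)).
pose H y := \sum_(x <- s) h x y.
have Hc : continuous H.
  rewrite /H; elim: (s) => [|z t ih] y.
    by under eq_fun do rewrite big_nil; exact: cst_continuous.
  by under eq_fun do rewrite big_cons; apply: cvgD; [exact: hc|exact: ih].
have H0 y : 0 < H y.
  have [x] := sP y; rewrite /H; elim: (s) => //= z t ih; rewrite big_cons.
  move=> [->|/ih{}ih] hx; first by rewrite ltr_pwDl// sumr_ge0.
  by rewrite ltr_wpDl// ih.
have pc x : continuous (fun y => h x y / H y).
  move=> y; apply: cvgM; first exact: hc.
  by apply: cvgV; [rewrite gt_eqF|exact: Hc].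
pose p x := mk_cfun (pc x).
pose w x := phi (p x).
have w0 x : 0 <= w x.
  by apply: state_ge0 => // y; rewrite mk_cfunE divr_ge0// ltW.
have psum (a : K -> R) y : (\sum_(x <- s) a x *: p x)`[y] =
    (\sum_(x <- s) a x * h x y) / H y.
  by rewrite cfun_sum mulr_suml; apply: eq_bigr => x _; rewrite cfunZ mulrA.
have phisum (a : K -> R) :
    phi (\sum_(x <- s) a x *: p x) = \sum_(x <- s) a x * w x.
  elim: (s) => [|x t ih]; first by rewrite !big_nil dual0.
  by rewrite !big_cons dualD dualZ ih.
have w1 : \sum_(x <- s) w x = 1.
  have [_ <-] := phiS.
  have -> : cfun_one = \sum_(x <- s) (1 : R) *: p x.
    apply: cfun_eq => y; rewrite psum mk_cfunE.
    under eq_bigr do rewrite mul1r.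
    by rewrite -/(H y) divff// gt_eqF.
  by rewrite phisum; apply: eq_bigr => x _; rewrite mul1r.
exists (\sum_(x <- s) w x *: state_ev (dirac_state x)).
  have := convex_comb_seq Acvx (s := s) w0 Ad.
  by rewrite w1 invr1 scale1r; apply; exact: ltr01.
move=> f ffs.
have -> : (\sum_(x <- s) w x *: state_ev (dirac_state x)) f =
    phi (\sum_(x <- s) f`[x] *: p x).
  rewrite phisum; elim: (s) => [|x t ih]; first by rewrite !big_nil.
  by rewrite !big_cons dual_addE ih dual_scaleE dirac_stateE mulrC.
apply: state_dist => // y; rewrite psum.
rewrite -[X in X - _](mulfK (lt0r_neq0 (H0 y))) -mulrBl normrM.
rewrite (gtr0_norm (x := _^-1)) ?invr_gt0// ler_pdivrMr//.
rewrite /H mulr_sumr -sumrB mulr_sumr (le_trans (ler_norm_sum _ _ _))//.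
apply: ler_sum => x _; rewrite -mulrBl normrM (ger0_norm (h0 x y)).
have [hxy|] := ltP 0 (h x y); last first.
  move=> hle; have -> : h x y = 0 by apply/le_anti; rewrite hle h0.
  by rewrite !mulr0.
rewrite ler_wpM2r// distrC (le_trans (D_le _ _ _ ffs))// ltW//.
exact: hD.
Qed.

End states.
Arguments states R {K} Kc.
Arguments cfun_one R {K} Kc.
Arguments dirac_state R {K} Kc x.

(** * Continuous affine functions on the space of states *)

Section state_midpoint.
Context {R : realType} {K : topologicalType} {Kc : compact [set: K]}.
Local Notation C := (cfun R Kc).
Local Notation L := (set_type (states R Kc)).
Local Notation "f `[ x ]" := (cfun_val f x) (at level 2, format "f `[ x ]").

Let half_ge0 : 0 <= 2^-1 :> R. Proof. by rewrite invr_ge0. Qed.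
Let half_le1 : 2^-1 <= 1 :> R. Proof. by rewrite invf_le1// ler1n. Qed.

Definition state_mid (mu nu : L) : L := SigSub (mem_set
  (state_convex (state_evP mu) (state_evP nu) half_ge0 half_le1)).

Lemma state_midE mu nu f :
  state_ev (state_mid mu nu) f = (state_ev mu f + state_ev nu f) / 2.
Proof.
rewrite [LHS](_ : _ = 2^-1 * state_ev mu f + (1 - 2^-1) * state_ev nu f)//.
have -> : 1 - 2^-1 = 2^-1 :> R by rewrite {1}(splitr 1) mul1r addrK.
by rewrite -mulrDr mulrC.
Qed.

Lemma state_mid_continuous : continuous (fun p : L * L => state_mid p.1 p.2).
Proof.
move=> p; apply: (state_ev_cvg (nbhs_filter _)) => f; rewrite state_midE.
under eq_fun do rewrite state_midE.
apply: cvgM; last exact: cvg_cst.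
apply: cvgD.
- by apply: cvg_state_ev; exact: cvg_fst.
- by apply: cvg_state_ev; exact: cvg_snd.
Qed.

(** The set Z of states at which both sides agree is closed, stable under
    midpoints, hence convex, and contains the Dirac measures, whose convex
    combinations are dense. *)
Lemma state_barycenter (h : L -> R) (g : C) : continuous h ->
    (forall mu nu, h (state_mid mu nu) = (h mu + h nu) / 2) ->
    (forall x, h (dirac_state R Kc x) = g`[x]) ->
  forall mu, h mu = state_ev mu g.
Proof.
move=> hc hm hd mu.
pose Z := [set nu : L | h nu = state_ev nu g].
have Zm nu nu' : Z nu -> Z nu' -> Z (state_mid nu nu').
  by move=> Zn Zn'; rewrite /Z /mkset hm state_midE Zn Zn'.
pose k nu := h nu - state_ev nu g.
have kc : continuous k.
  by move=> nu; exact: cvgB (hc nu) (@state_ev_continuous _ _ Kc g nu).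
have kZ nu : Z nu <-> k nu = 0.
  by rewrite /Z /k; split=> [->|/eqP]; rewrite ?subrr// subr_eq0 => /eqP.
pose A := [set phi : dual C | exists2 nu : L, state_ev nu = phi & Z nu].
have Ad x : A (state_ev (dirac_state R Kc x)).
  by exists (dirac_state R Kc x) => //; rewrite /Z /mkset hd dirac_stateE.
have Acvx phi psi (a : R) : A phi -> A psi -> 0 <= a -> a <= 1 ->
    A (a *: phi + (1 - a) *: psi).
  move=> [nu <- Znu] [nu' <- Znu'].
  have ex (b : R) : exists mu : L, 0 <= b -> b <= 1 ->
      state_ev mu = b *: state_ev nu + (1 - b) *: state_ev nu'.
    have [b0|] := boolP (0 <= b); last by exists nu.
    have [b1|] := boolP (b <= 1); last by exists nu.
    have S := state_convex (state_evP nu) (state_evP nu') b0 b1.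
    by exists (SigSub (mem_set S)).
  have [c cP] := choice ex.
  have cE (b : R) f : 0 <= b -> b <= 1 ->
      state_ev (c b) f = b * state_ev nu f + (1 - b) * state_ev nu' f.
    by move=> b0 b1; rewrite cP.
  (* c b is meaningful on [0, 1] only; clamp makes the path continuous on R. *)
  pose clamp (b : R) := Order.max 0 (Order.min b 1).
  have clamp0 b : 0 <= clamp b by rewrite le_max lexx.
  have clamp1 b : clamp b <= 1 by rewrite ge_max ler01 ge_min lexx orbT.
  have clampE b : 0 <= b -> b <= 1 -> clamp b = b.
    by move=> b0 b1; rewrite /clamp min_l// max_r.
  have clampc : continuous clamp.
    move=> b; apply: (@continuous_max R R (cst 0) (fun b => Order.min b 1) b).
      exact: cst_continuous.
    apply: (@continuous_min R R id (cst 1) b); first exact: cvg_id.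
    exact: cst_continuous.
  have cc : continuous (c \o clamp).
    move=> b; apply: (state_ev_cvg (nbhs_filter _)) => f /=; rewrite cE//.
    under eq_fun do rewrite cE//.
    apply: cvgD; apply: cvgM; try exact: cvg_cst; first exact: clampc.
    by apply: cvgB; [exact: cvg_cst|exact: clampc].
  have : forall b : R, 0 <= b -> b <= 1 -> [set b | k (c (clamp b)) = 0] b.
    apply: midpoint_closed_itv.
    - have /continuous_closedP kcc : continuous (k \o (c \o clamp)).
        by move=> b; apply: continuous_comp; [exact: cc|exact: kc].
      exact: (kcc [set 0] (@closed_eq R 0)).
    - rewrite /= (_ : c (clamp 0) = nu'); first exact/kZ.
      apply: state_ev_inj => f.
      by rewrite cE// clampE// subr0 mul0r mul1r add0r.
    - rewrite /= (_ : c (clamp 1) = nu); first exact/kZ.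
      apply: state_ev_inj => f.
      by rewrite cE// clampE// subrr mul0r mul1r addr0.
    - move=> a1 a2 a10 a12 a21 /= /kZ Z1 /kZ Z2; apply/kZ.
      have a11 := le_trans a12 a21; have a20 := le_trans a10 a12.
      rewrite (_ : c _ = state_mid (c (clamp a1)) (c (clamp a2))).
        exact: Zm.
      apply: state_ev_inj => f.
      rewrite state_midE !cE// !clampE//; first by field.
        by rewrite divr_ge0// addr_ge0.
      by rewrite ler_pdivrMr// mul1r lerD.
  move=> H a0 a1; exists (c (clamp a)); first by rewrite clampE// cP.
  by apply/kZ; exact: H.
pose F : set_system L := filter_from [set: seq C * {posnum R}]
  (fun p => [set nu | Z nu /\ forall f, List.In f p.1 ->
     `|state_ev mu f - state_ev nu f| <= p.2%:num]).
have FF : ProperFilter F.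
  apply: filter_from_proper; last first.
    move=> [fs e] _; have [|_ [nu <- Znu] nuP] :=
      @state_dirac_approx _ _ Kc (state_ev mu) fs e%:num A (state_evP mu)
        _ Ad Acvx.
      by [].
    by exists nu.
  apply: filter_from_filter; first by exists ([::], 1%:pos).
  move=> [s1 e1] [s2 e2] _ _.
  exists ((s1 ++ s2)%list, (Num.min e1%:num e2%:num)%:pos) => //.
  move=> nu [Znu /= nuP].
  split; split=> // f fs; (apply: le_trans; first apply: nuP).
  - by apply/List.in_or_app; left.
  - by rewrite ge_min lexx.
  - by apply/List.in_or_app; right.
  - by rewrite ge_min lexx orbT.
have Fmu : (id : L -> L) @ F --> mu.
  apply: state_ev_cvg => f; apply/cvgrPdist_le => e e0.
  by exists ([:: f], PosNum e0) => // nu [_ /=]; apply; left.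
have kF : k nu @[nu --> F] --> k mu.
  by apply: continuous_cvg Fmu; exact: kc.
apply/kZ; apply: (hausdorff_cvg_eq _ _ kF); first exact: Rhausdorff.
apply: cvg_near_cst; exists ([::], 1%:pos) => // nu [Znu _] /=.
exact/kZ.
Qed.

End state_midpoint.

(** * From retractions of the states to projections on C(K) *)

Section projections_from_retractions.
Context {R : realType} {K : topologicalType} {Kc : compact [set: K]}.
Local Notation C := (cfun R Kc).
Local Notation L := (set_type (states R Kc)).
Local Notation "f `[ x ]" := (cfun_val f x) (at level 2, format "f `[ x ]").
Local Notation delta := (dirac_state R Kc).
Context {disp : Order.disp_t} {I : porderType disp} {r : I -> L -> L}.
Context (rS : retractional_skeleton R r).
Context (Dcvx : convex_set (in_dual (\bigcup_s range (r s)))).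

Let Lc : compact [set: L].
Proof. by apply: compact_set_type; exact: states_compact. Qed.

Let Lh : hausdorff_space L.
Proof. by apply: hausdorff_set_type; exact: weak_star_hausdorff. Qed.

Let rc s : continuous (r s).
Proof. exact: (retractional_continuous rS). Qed.

Let r_idem s mu : r s (r s mu) = r s mu.
Proof. exact: (retractional_idem rS). Qed.

Let A : set I := hom_index (r := r) state_mid.

Let A_cofinal : cofinal A.
Proof.
move=> s; apply: (hom_index_cofinal Lc Lh rS state_mid_continuous) => mu nu.
move=> Dmu Dnu; move/convex_setP : Dcvx => Dcvx'.
have half_ge0 : 0 <= 2^-1 :> R by rewrite invr_ge0.
have half_le1 : 2^-1 <= 1 :> R by rewrite invf_le1// ler1n.
have [||b Db bE] :=
  Dcvx' (state_ev mu) (state_ev nu) 2^-1 _ _ half_ge0 half_le1.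
- by exists mu.
- by exists nu.
suff -> : state_mid mu nu = b by [].
by apply: val_inj; exact: esym bE.
Qed.

Let A_sup : sup_closed A.
Proof.
move=> s t sS st sA.
exact: (hom_index_sup Lh rS state_mid_continuous sS st sA).
Qed.

Let J := sub_index A.

Let P_exists : exists P : J -> C -> C,
  forall s f x, (P s f)`[x] = state_ev (r (index_val s) (delta x)) f.
Proof.
have Pc (s : J) f :
    continuous (fun x => state_ev (r (index_val s) (delta x)) f).
  move=> x; apply: cvg_state_ev.
  by apply: continuous_comp; [exact: dirac_state_continuous|exact: rc].
by exists (fun s f => mk_cfun Kc (Pc s f)).
Qed.

Let P := projT1 (cid P_exists).

Let PE s f x : (P s f)`[x] = state_ev (r (index_val s) (delta x)) f.
Proof. exact: (projT2 (cid P_exists)). Qed.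

(** Since r s is affine, this identity needs to be known at Dirac measures only,
    where it is the definition of P. *)
Let P_state s f mu : state_ev mu (P s f) = state_ev (r (index_val s) mu) f.
Proof.
apply/esym.
apply: (state_barycenter (h := fun mu => state_ev (r (index_val s) mu) f)).
- move=> nu; exact: cvg_state_ev (@rc (index_val s) nu).
- by move=> nu nu'; rewrite (index_valP s) state_midE.
- by move=> x; rewrite PE.
Qed.

Let P_eq s f : (forall mu, state_ev (r (index_val s) mu) f = state_ev mu f) ->
  P s f = f.
Proof. by move=> H; apply: cfun_eq => x; rewrite PE H dirac_stateE. Qed.

Let P_linear s : linear (P s).
Proof. by move=> a f g; apply: cfun_eq => x; rewrite cfunD cfunZ !PE dualP. Qed.

Let P_le1 s f : `|P s f| <= `|f|.
Proof.
apply: cfun_norm_le => // x; rewrite PE.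
by have [/dual_ballP] := state_evP (r (index_val s) (delta x)).
Qed.

Let P_sub s f g : P s (f - g) = P s f - P s g.
Proof. by rewrite addrC -scaleN1r P_linear scaleN1r addrC. Qed.

Let P_comp_l s t f : (s <= t)%O -> P s (P t f) = P s f.
Proof.
move=> st; apply: cfun_eq => x; rewrite !PE P_state.
by rewrite (skeleton_le_r rS) ?index_val_le.
Qed.

Let P_comp_r s t f : (s <= t)%O -> P t (P s f) = P s f.
Proof.
move=> st; apply: cfun_eq => x; rewrite !PE P_state.
by rewrite (skeleton_le_l rS) ?index_val_le.
Qed.

Let P_idem s f : P s (P s f) = P s f.
Proof. by rewrite P_comp_l. Qed.

Let P_cover f : exists s, P s f = f.
Proof.
have [s sP] := skeleton_factor Lc Lh rS (@state_ev_continuous _ _ Kc f).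
have [t st At] := A_cofinal s; exists (SigSub (mem_set At)).
by apply: P_eq => mu; exact: sP.
Qed.

Let P_sup (s : nat -> J) t : (forall n, (s n < s n.+1)%O) ->
  supremums (range s) t -> range (P t) = closure (\bigcup_n range (P (s n))).
Proof.
move=> sS st.
have s_t n : (s n <= t)%O by have [ts _] := st; apply: ts; exists n.
have sS' n : (s n <= s n.+1)%O by exact: ltW.
have st' : supremums (range (index_val \o s)) (index_val t).
  exact: sub_index_supremum (retractional_complete rS) A_sup sS' st.
rewrite eqEsubset; split=> f.
  move=> [g _ <-] V /nbhs_ballP[e e0 eV].
  have e20 : 0 < e / 2 by rewrite divr_gt0.
  have [N NP] :=
    skeleton_sup_unif Lc Lh rS (@state_ev_continuous _ _ Kc g) sS' st' e20.
  exists (P (s N) g); split; first by exists N => //; exists g.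
  apply: eV; rewrite -ball_normE /=.
  rewrite (@le_lt_trans _ _ (e / 2)) ?ltr_pdivrMr ?ltr_pMr ?ltr1n//.
  apply: cfun_norm_le; first exact: ltW.
  by move=> x; rewrite cfunD cfunN !PE distrC; apply/ltW; exact: NP.
move=> fcl; exists f => //; apply/eqP; rewrite -subr_eq0 -normr_le0.
apply/ler_addgt0Pl => e e0; rewrite addr0.
have e20 : 0 < e / 2 by rewrite divr_gt0.
have [g [[n _ [h _ hg]]]] := fcl _ (nbhsx_ballx f _ e20).
rewrite -ball_normE /= => fg.
have tg : P t g = g by rewrite -hg P_comp_r.
have -> : P t f - f = P t (f - g) + (g - f) by rewrite P_sub tg subrKA.
rewrite (splitr e) (le_trans (ler_normD _ _))// lerD//.
  by rewrite (le_trans (P_le1 _ _))// ltW.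
by rewrite distrC ltW.
Qed.

(** A function f in the range of P s is determined by the values at f of the
    states in the range M of r s, which is compact with a countable base. It is
    described up to 2 / (n + 1) by a finite cover of M by basic sets together
    with a rational approximation on each of them; there are countably many such
    descriptions, and one function of the range is chosen for each of them. *)
Let P_separable s : separable (set_type (range (P s))).
Proof.
pose rs := r (index_val s); pose M := range rs.
have [W Wo Wb] : countable_base_on M by exact: (skeleton_range_base Lc rS).
pose osc (p : nat * rat) (e : R) f :=
  forall mu, W p.1 mu -> M mu -> `|state_ev mu f - ratr p.2| < e.
pose good (c : seq (nat * rat) * nat) f := range (P s) f /\
  (forall mu, M mu -> exists2 p, List.In p c.1 & W p.1 mu) /\
  (forall p, List.In p c.1 -> osc p c.2.+1%:R^-1 f).
have good_ex f n : range (P s) f -> exists l, good (l, n) f.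
  move=> Pf; have e0 : 0 < n.+1%:R^-1 / 2 :> R by rewrite divr_gt0.
  have ex mu : exists p : nat * rat, W p.1 (rs mu) /\ osc p n.+1%:R^-1 f.
    have [q /andP[q1 q2]] : exists q : rat,
        state_ev (rs mu) f < ratr q < state_ev (rs mu) f + n.+1%:R^-1 / 2.
      have [q] := rat_in_itvoo (ltr_pwDr e0 (lexx (state_ev (rs mu) f))).
      by rewrite in_itv /= => qP; exists q.
    have near_nu : \forall nu \near rs mu,
        `|state_ev (rs mu) f - state_ev nu f| < n.+1%:R^-1 / 2.
      have /cvgrPdist_lt H :
          state_ev nu f @[nu --> rs mu] --> state_ev (rs mu) f.
        exact: state_ev_continuous.
      exact: H.
    have [|i Wi iV] := Wb _ _ _ near_nu; first by exists mu.
    exists (i, q); split=> // nu /= Wnu Mnu.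
    have /= nun := iV nu (conj Wnu Mnu).
    rewrite -(subrKA (state_ev (rs mu) f)) (splitr n.+1%:R^-1).
    rewrite (le_lt_trans (ler_normD _ _))// ltrD//; first by rewrite distrC.
    by rewrite distrC gtr0_norm ?subr_gt0// ltrBlDl.
  have [p pP] := choice ex.
  have [t tP] := @compact_finite_cover L (fun mu => rs @^-1` (W (p mu).1)) Lc
    (fun mu => rc (open_nbhs_nbhs (conj (Wo _) (pP mu).1))).
  exists (map p t); split=> //; split=> [_ [mu _ <-]|q /= ].
    have [nu nut Wnu] := tP (rs mu); exists (p nu); first exact: List.in_map.
    by move: Wnu; rewrite /= /rs r_idem.
  by move=> /List.in_map_iff[mu [<- _]]; have [] := pP mu.
have good_close c f g : good c f -> good c g -> `|f - g| <= 2 * c.2.+1%:R^-1.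
  move=> [[f' _ ff'] [cov oscf]] [[g' _ gg'] [_ oscg]].
  apply: cfun_norm_le => [|x]; first by rewrite mulr_ge0.
  have Pff : P s f = f by rewrite -ff' P_idem.
  have Pgg : P s g = g by rewrite -gg' P_idem.
  rewrite cfunD cfunN -Pff -Pgg !PE.
  have Mx : M (rs (delta x)) by exists (delta x).
  have [p pc Wp] := cov _ Mx.
  rewrite -(subrKA (ratr p.2)) mulr_natl mulr2n (le_trans (ler_normD _ _))//.
  rewrite lerD//; first by apply/ltW/oscf.
  by rewrite distrC; apply/ltW/oscg.
have [gs gsP] : exists gs : seq (nat * rat) * nat -> set_type (range (P s)),
    forall c, (exists f, good c f) -> good c (set_val (gs c)).
  have P0 : range (P s) (P s 0) by exists 0.
  have ex c : exists g : set_type (range (P s)),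
      (exists f, good c f) -> good c (set_val g).
    have [[f gf]|nf] := pselect (exists f, good c f).
      have [Pf _] := gf.
      by exists (SigSub (mem_set Pf)).
    by exists (SigSub (mem_set P0)).
  by have [gs gsP] := choice ex; exists gs.
exists (range gs).
  exact: (sub_countable (card_image_le _ _) (countableP _)).
move=> U [f Uf] Uo.
have [B Bo BU] : exists2 B : set C, open B & set_val @^-1` B = U.
  by have [B Bo BU] := Uo; exists B.
have Bf : B (set_val f) by move: Uf; rewrite -BU.
have /nbhs_ballP[e e0 eB] : nbhs (set_val f) B by exact: open_nbhs_nbhs.
have e20 : 0 < e / 2 by rewrite divr_gt0.
have [n] := ltr_add_invr e20; rewrite add0r => ne.
have Pf : range (P s) (set_val f) by exact: (set_valP f).
have [l lP] := good_ex _ n Pf.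
have gP := gsP (l, n) (ex_intro _ _ lP).
exists (gs (l, n)); split; last by exists (l, n).
rewrite -BU /=; apply: eB; rewrite -ball_normE /=.
rewrite (le_lt_trans (good_close _ _ _ lP gP))//.
by rewrite mulrC -ltr_pdivlMr.
Qed.

Lemma projectional_skeleton_of_states : has_projectional_skeleton 1 C.
Proof.
exists disp, J, P; split; last first.
  move=> s; apply/(op_norm_le1P (@P_linear s)); last exact: P_le1.
  apply: (linear_bounded_fun_norm (M := 1)) => f.
  by rewrite mul1r; exact: P_le1.
split=> //.
- exact: sub_index_directed A_cofinal (retractional_directed rS).
- exact: sub_index_complete (retractional_complete rS) A_sup.
- move=> s; apply: (linear_bounded_fun_norm (M := 1)) => f.
  by rewrite mul1r; exact: P_le1.
- rewrite eqEsubset; split=> // f _; have [s sf] := P_cover f.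
  by exists s => //; exists f.
- move=> s t st; split; apply/funext => f /=; first by rewrite P_comp_l.
  by rewrite P_comp_r.
Qed.

End projections_from_retractions.

(** * Riesz representation: the outer measure of a state *)

Section riesz.
Context {R : realType} {K : topologicalType} (Kc : compact [set: K]).
Context (Kh : hausdorff_space K).
Local Notation C := (cfun R Kc).
Local Notation "f `[ x ]" := (cfun_val f x) (at level 2, format "f `[ x ]").
Context (phi : dual C) (phiS : states R Kc phi).

Let one : C := cfun_one R Kc.

Let oneE x : one`[x] = 1. Proof. by []. Qed.

Let phi_one : phi one = 1. Proof. by have [] := phiS. Qed.

Let phi_cst c : phi (c *: one) = c. Proof. by rewrite dualZ phi_one mulr1. Qed.

Let phi_ge0 f : (forall x, 0 <= f`[x]) -> 0 <= phi f.
Proof. exact: state_ge0. Qed.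

Let phi_le f g : (forall x, f`[x] <= g`[x]) -> phi f <= phi g.
Proof. exact: state_le. Qed.

Definition below (U : set K) : set C :=
  [set f | forall x, 0 <= f`[x] /\ f`[x] <= \1_U x].

Lemma below0 U : below U 0.
Proof. by move=> x; split. Qed.

Lemma below_le1 U f x : below U f -> f`[x] <= 1.
Proof.
by move=> /(_ x)[_]; move/le_trans; apply; rewrite indicE lern1 leq_b1.
Qed.

Lemma below_out U f x : below U f -> ~ U x -> f`[x] = 0.
Proof.
move=> /(_ x)[f0 fU] Ux; apply/le_anti; rewrite f0 andbT (le_trans fU)//.
by rewrite indicE memNset.
Qed.

Lemma belowP U f : (forall x, 0 <= f`[x]) -> (forall x, U x -> f`[x] <= 1) ->
  (forall x, ~ U x -> f`[x] <= 0) -> below U f.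
Proof.
move=> f0 f1 fU x; split=> //; rewrite indicE.
have [Ux|Ux] := pselect (U x); first by rewrite mem_set// f1.
by rewrite memNset// fU.
Qed.

Let phi_below U f : below U f -> 0 <= phi f <= 1.
Proof.
move=> fU; rewrite phi_ge0 => [|x]; last by have [] := fU x.
by rewrite -phi_one phi_le// => x; exact: (below_le1 x fU).
Qed.

(** The measure of an open set; it has no particular meaning on other sets. *)
Definition inner (U : set K) : R := sup [set phi f | f in below U].

Let inner_has_sup U : has_sup [set phi f | f in below U].
Proof.
split; first by exists (phi 0), 0 => //; exact: below0.
by exists 1 => _ [f /phi_below/andP[] _ ? <-].
Qed.

Lemma inner_ge U f : below U f -> phi f <= inner U.
Proof. by move=> fU; apply: ub_le_sup; [case: (inner_has_sup U)|exists f]. Qed.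

Lemma inner_le U c : (forall f, below U f -> phi f <= c) -> inner U <= c.
Proof.
move=> H; apply: ge_sup; first by case: (inner_has_sup U).
by move=> _ [f fU <-]; exact: H.
Qed.

Lemma inner_ge0 U : 0 <= inner U.
Proof. by rewrite -(dual0 phi) inner_ge//; exact: below0. Qed.

Lemma inner_le1 U : inner U <= 1.
Proof. by apply: inner_le => f /phi_below/andP[]. Qed.

Lemma innerT : inner setT = 1.
Proof.
apply/le_anti; rewrite inner_le1/= -phi_one inner_ge//.
by apply: belowP => x; rewrite oneE ?ler01 ?lexx// => /(_ Logic.I).
Qed.

Lemma inner0 : inner set0 = 0.
Proof.
apply/le_anti; rewrite inner_ge0 andbT; apply: inner_le => f f0.
suff -> : f = 0 by rewrite dual0.
by apply: cfun_eq => x; rewrite (below_out f0).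
Qed.

Lemma inner_mono U V : U `<=` V -> inner U <= inner V.
Proof.
move=> UV; apply: inner_le => f fU; apply: inner_ge; apply: belowP => x.
- by have [] := fU x.
- by move=> _; exact: (below_le1 x fU).
- by move=> Vx; rewrite (below_out fU)//; move=> Ux; exact/Vx/UV.
Qed.

Lemma urysohn_below (U : set K) x : open U -> U x ->
  exists2 g : C, below U g & g`[x] = 1.
Proof.
move=> Uo Ux.
have us : uniform_separator (~` U) [set x].
  apply: (normal_uniform_separator (compact_normal Kh Kc)).
  - exact: open_closedC.
  - by apply: accessible_closed_set1; exact: hausdorff_accessible.
  - by rewrite -subset0 => y [Uy /= yx]; apply: Uy; rewrite yx.
exists (mk_cfun Kc (@Urysohn_continuous K R (~` U) [set x])); last first.
  by rewrite mk_cfunE; apply: (Urysohn_sub1 us); exists x.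
have rng y : 0 <= Urysohn (R := R) (~` U) [set x] y <= 1.
  have := @Urysohn_range K R (~` U) [set x] (Urysohn (~` U) [set x] y).
  by rewrite /= in_itv /=; apply; exists y.
apply: belowP => y; rewrite mk_cfunE.
- by have /andP[] := rng y.
- by have /andP[] := rng y.
- by move=> Uy; have -> : Urysohn (R := R) (~` U) [set x] y = 0
    by apply: (Urysohn_sub0 us); exists y.
Qed.

Lemma cfun_max_continuous (f g : C) :
  continuous (fun x => Order.max f`[x] g`[x]).
Proof.
move=> x; apply: (@continuous_max _ _ (cfun_val f) (cfun_val g) x);
  exact: cfun_continuous.
Qed.

Definition cfun_max (f g : C) : C := mk_cfun Kc (@cfun_max_continuous f g).

Lemma cfun_maxE f g x : (cfun_max f g)`[x] = Order.max f`[x] g`[x].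
Proof. by []. Qed.

Lemma below_max U f g : below U f -> below U g -> below U (cfun_max f g).
Proof.
move=> fU gU x; rewrite cfun_maxE le_max ge_max.
by have [-> ->] := fU x; have [_ ->] := gU x.
Qed.

Lemma phi_sum (T : Type) (s : seq T) (F : T -> C) :
  phi (\sum_(i <- s) F i) = \sum_(i <- s) phi (F i).
Proof.
by elim: s => [|x s ih]; rewrite ?big_nil ?dual0// !big_cons dualD ih.
Qed.

(** Given f below the union, every point x has a function below one of the U n
    that exceeds f - e / 2 near x. Finitely many of them suffice; the maximum
    h n of those attached to U n is below U n, and f <= h 0 + ... + h (N-1)
    + e / 2. *)
Lemma inner_bigcup (U : nat -> set K) (e : R) : (forall n, open (U n)) ->
  0 < e -> exists N, inner (\bigcup_n U n) <= \sum_(n < N) inner (U n) + e.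
Proof.
move=> Uo e0.
have e20 : 0 < e / 2 by rewrite divr_gt0.
have [_ [f fU <-] innerf] := sup_adherent e20 (inner_has_sup (\bigcup_n U n)).
have ex x : exists p : nat * C, below (U p.1) p.2 /\ f`[x] < p.2`[x] + e / 2.
  have [[n _ Ux]|nU] := pselect ((\bigcup_n U n) x).
    have [g gU g1] := urysohn_below (Uo n) Ux; exists (n, g); split=> //=.
    by rewrite g1 (le_lt_trans (below_le1 x fU))// ltrDl.
  exists (0, 0); split; first exact: below0.
  by rewrite (below_out fU)// add0r.
have [p pP] := choice ex.
have near_x x : \forall y \near x, f`[y] < (p x).2`[y] + e / 2.
  have kc : continuous (fun y => (p x).2`[y] + e / 2 - f`[y]).
    move=> y; apply: cvgB; last exact: cfun_continuous.
    by apply: cvgD; [exact: cfun_continuous|exact: cvg_cst].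
  have [_ px] := pP x.
  have := cvgr_gt _ (kc x) 0; rewrite subr_gt0 => /(_ _ px).
  by apply: filterS => y; rewrite subr_gt0.
have [s sP] := compact_finite_cover Kc near_x.
have [h [hU hP]] : exists h : nat -> C, (forall n, below (U n) (h n)) /\
    forall x, List.In x s -> forall y, (p x).2`[y] <= (h (p x).1)`[y].
  elim: (s) => [|x t [h [hU hP]]].
    by exists (fun=> 0); split=> // n; exact: below0.
  exists (fun n => if n == (p x).1 then cfun_max (p x).2 (h n) else h n); split.
    move=> n; case: eqP => [->|_] //; apply: below_max => //.
    by have [] := pP x.
  move=> z /= [<-|zt] y; first by rewrite eqxx cfun_maxE le_max lexx.
  case: eqP => _; last exact: hP.
  by rewrite cfun_maxE le_max hP// orbT.
pose N := (\max_(x <- s) (p x).1).+1.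
exists N.
have sN x : List.In x s -> ((p x).1 < N)%N.
  rewrite /N ltnS; elim: (s) => //= z t ih [->|/ih xt]; rewrite big_cons.
    exact: leq_maxl.
  by rewrite (leq_trans xt)// leq_maxr.
have phif : phi f <= \sum_(n < N) phi (h n) + e / 2.
  rewrite -phi_sum -[e / 2]phi_cst -dualD; apply: phi_le => y.
  rewrite cfunD cfun_sum cfunZ oneE mulr1.
  have [x xs fx] := sP y; rewrite (le_trans (ltW fx))// lerD2r.
  rewrite (le_trans (hP x xs y))// (bigD1 (Ordinal (sN x xs)))//= lerDl.
  by apply: sumr_ge0 => n _; have [] := hU n y.
rewrite (splitr e) addrA -lerBlDr (le_trans (ltW innerf))//.
rewrite (le_trans phif)// lerD2r; apply: ler_sum => n _; exact: inner_ge.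
Qed.

(** Take for W the part of V where f < e. If g is below W, then the positive
    part of f - e and g are not simultaneously nonzero, so that their sum is
    below V. *)
Lemma inner_split (U V : set K) (e : R) f : open V -> below (V `&` U) f ->
    0 < e ->
  exists W, [/\ open W, V `\` U `<=` W & phi f + inner W <= inner V + e].
Proof.
move=> Vo fVU e0; pose W := V `&` [set x | f`[x] < e]; exists W.
have f_lt : open [set x | f`[x] < e].
  have /continuousP fc := @cfun_continuous _ _ Kc f.
  exact: (fc [set y : R | y < e] (@open_lt R e)).
split; first exact: openI.
  by move=> x [Vx Ux]; split=> //=; rewrite (below_out fVU)// => -[].
rewrite -lerBrDl; apply: inner_le => g gW; rewrite lerBrDl.
pose f' := cfun_max 0 (f - e *: one).
have f'E x : f'`[x] = Order.max 0 (f`[x] - e).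
  by rewrite cfun_maxE cfunD cfunN cfunZ oneE mulr1.
have f'V : below V (f' + g).
  have g0 x : 0 <= g`[x] by have [] := gW x.
  have f0 x : 0 <= f`[x] by have [] := fVU x.
  apply: belowP => x; rewrite cfunD f'E.
  - by rewrite addr_ge0// le_max lexx.
  - have [fe|fe] := ltP f`[x] e.
      by rewrite max_l ?subr_le0 ?(ltW fe)// add0r (below_le1 x gW).
    rewrite (below_out gW) ?addr0; last by move=> [_ /=]; rewrite ltNge fe.
    by rewrite ge_max ler01/= lerBlDr (le_trans (below_le1 x fVU))// lerDl ltW.
  - move=> Vx; rewrite (below_out gW) ?addr0; last by move=> [].
    rewrite (below_out fVU); last by move=> [].
    by rewrite sub0r max_l// oppr_le0 ltW.
rewrite (le_trans _ (lerD (inner_ge f'V) (lexx e)))// dualD addrAC lerD2r.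
rewrite -[e]phi_cst -dualD; apply: phi_le => x.
by rewrite cfunD f'E cfunZ oneE mulr1 -lerBlDr le_max lexx orbT.
Qed.

Definition outer (A : set K) : R :=
  inf [set inner U | U in [set U | open U /\ A `<=` U]].

Let outer_has_inf A : has_inf [set inner U | U in [set U | open U /\ A `<=` U]].
Proof.
split; first by exists (inner setT), setT => //; split=> //; exact: openT.
by exists 0 => _ [U _ <-]; exact: inner_ge0.
Qed.

Lemma outer_le A U : open U -> A `<=` U -> outer A <= inner U.
Proof. by move=> Uo AU; apply: ge_inf; [case: (outer_has_inf A)|exists U]. Qed.

Lemma outer_ge A c : (forall U, open U -> A `<=` U -> c <= inner U) ->
  c <= outer A.
Proof.
move=> H; apply: lb_le_inf; first by case: (outer_has_inf A).
by move=> _ [U [Uo AU] <-]; exact: H.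
Qed.

Lemma outer_open U : open U -> outer U = inner U.
Proof.
move=> Uo; apply/le_anti; rewrite outer_le//=.
by apply: outer_ge => V Vo UV; exact: inner_mono.
Qed.

Lemma outer_adherent A e : 0 < e ->
  exists U, [/\ open U, A `<=` U & inner U <= outer A + e].
Proof.
move=> e0; have [_ [U [Uo AU] <-] Ue] := inf_adherent e0 (outer_has_inf A).
by exists U; split=> //; exact: ltW.
Qed.

Lemma outer_mono A B : A `<=` B -> outer A <= outer B.
Proof.
by move=> AB; apply: outer_ge => U Uo BU; apply: outer_le => // x /AB/BU.
Qed.

Lemma outer_ge0 A : 0 <= outer A.
Proof. by apply: outer_ge => U _ _; exact: inner_ge0. Qed.

Definition outerE (A : set K) : \bar R := (outer A)%:E.

Let outerE0 : outerE set0 = 0%E.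
Proof. by rewrite /outerE outer_open ?inner0//; exact: open0. Qed.

Let outerE_ge0 A : (0 <= outerE A)%E.
Proof. by rewrite lee_fin outer_ge0. Qed.

Let outerE_mono : {homo outerE : A B / A `<=` B >-> (A <= B)%E}.
Proof. by move=> A B AB; rewrite lee_fin outer_mono. Qed.

Let outerE_sigma_subadditive : sigma_subadditive outerE.
Proof.
move=> F; apply/lee_addgt0Pr => e e0.
have [U UP] := choice (fun n => @outer_adherent (F n) (e / 2 / (2 ^ n.+1)%:R)
  ltac:(by rewrite !divr_gt0// ltr0n expn_gt0)).
have Uo n : open (U n) by have [] := UP n.
have e20 : 0 < e / 2 by rewrite divr_gt0.
have [N NP] := inner_bigcup Uo e20.
apply: (@le_trans _ _ (\sum_(n < N) inner (U n) + e / 2)%:E).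
  rewrite lee_fin (le_trans _ NP)//; apply: outer_le; first exact: bigcup_open.
  by apply: subset_bigcup => n _; have [] := UP n.
rewrite [X in (_ + X%:E)%E](splitr e) !EFinD addeA leeD2r//.
apply: le_trans (epsilon_trick xpredT _ _) => [|n|];
  [|exact: outerE_ge0|exact: ltW].
rewrite -sumEFin; apply: le_trans (nneseries_lim_ge N _); last first.
  by move=> n _ _; rewrite adde_ge0// lee_fin divr_ge0// ltW.
rewrite big_mkord; apply: lee_sum => n _.
by rewrite -EFinD lee_fin; have [] := UP n.
Qed.

Definition riesz_outer : {outer_measure set K -> \bar R} :=
  HB.pack outerE (isOuterMeasure.Build R K outerE outerE0 outerE_ge0
    outerE_mono outerE_sigma_subadditive).

(** It suffices to split the open sets V that contain X, and inner_split does
    it. *)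
Lemma open_caratheodory U : open U -> riesz_outer.-caratheodory U.
Proof.
move=> Uo; apply: le_caratheodory_measurable => X; rewrite /=.
rewrite -EFinD lee_fin; apply: outer_ge => V Vo XV.
apply/ler_addgt0Pr => e e0.
have VUo : open (V `&` U) by exact: openI.
rewrite -lerBrDr (le_trans (outer_le VUo _))//; first exact: setSI.
apply: inner_le => f fVU; rewrite lerBrDr.
have [W [Wo VUW]] := inner_split Vo fVU e0; apply: le_trans.
rewrite lerD2l; apply: outer_le => // x [Xx Ux]; apply: VUW; split=> //.
exact: XV.
Qed.

Lemma outerC A : riesz_outer.-caratheodory A -> outer A + outer (~` A) = 1.
Proof.
move=> /(_ setT); rewrite !setTI /= /outerE -EFinD => -[<-].
by rewrite outer_open ?innerT//; exact: openT.
Qed.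

End riesz.

(** * Riesz representation: the measure and its integral *)

Section borel_integral.
Context {R : realType} {K : topologicalType} {Kc : compact [set: K]} {x0 : K}.
Local Notation C := (cfun R Kc).
Local Notation "f `[ x ]" := (cfun_val f x) (at level 2, format "f `[ x ]").
Context (mu : probability (borel x0) R).

Lemma cfun_measurable (f : C) :
  measurable_fun [set: borel x0] (cfun_val f : borel x0 -> R).
Proof.
apply: (measurability _ (measurable_realfun.RGenOInfty.measurableE R)).
move=> _ [_ [a ->] <-]; rewrite setTI; apply: sub_sigma_algebra.
have /continuousP fc := @cfun_continuous _ _ Kc f.
by apply: fc; exact: rray_open.
Qed.

Lemma cfun_integrable (f : C) :
  mu.-integrable [set: borel x0] (fun x => (f`[x])%:E).
Proof.
apply: (measurable_bounded_integrable
  (f := cfun_val f : borel x0 -> R) measurableT).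
- by rewrite (le_lt_trans (probability_le1 _ _))// ltry.
- exact: cfun_measurable.
- exists `|f|; split; first exact: num_real.
  by move=> M fM x _ /=; rewrite (le_trans (cfun_le_norm f x))// ltW.
Qed.

Definition cfun_integral (f : C) : R := Rintegral mu setT (cfun_val f).

Lemma cfun_integralE f : (cfun_integral f)%:E = (\int[mu]_x (f`[x])%:E)%E.
Proof.
rewrite /cfun_integral /Rintegral fineK//.
by apply: integrable_fin_num => //; exact: cfun_integrable.
Qed.

Lemma cfun_integral_linear (a : R) f g :
  cfun_integral (a *: f + g) = a * cfun_integral f + cfun_integral g.
Proof.
apply: EFin_inj; rewrite EFinD EFinM !cfun_integralE.
under eq_integral do rewrite cfunD cfunZ EFinD EFinM.
rewrite integralD//=; last 2 first.
- by apply: integrableZl => //; exact: cfun_integrable.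
- exact: cfun_integrable.
by rewrite integralZl//; exact: cfun_integrable.
Qed.

Lemma cfun_integral_cst (a : R) : cfun_integral (a *: cfun_one R Kc) = a.
Proof.
apply: EFin_inj; rewrite cfun_integralE.
under eq_integral do rewrite cfunZ mulr1.
by rewrite integral_cst//= probability_setT mule1.
Qed.

Lemma cfun_integral_sum (T : Type) (s : seq T) (F : T -> C) :
  cfun_integral (\sum_(i <- s) F i) = \sum_(i <- s) cfun_integral (F i).
Proof.
elim: s => [|x s ih].
  by rewrite !big_nil -[RHS](cfun_integral_cst 0) scale0r.
by rewrite !big_cons -[F x]scale1r cfun_integral_linear mul1r ih scale1r.
Qed.

Lemma cfun_integral_ge0 f : (forall x, 0 <= f`[x]) -> 0 <= cfun_integral f.
Proof.
move=> f0; rewrite -lee_fin cfun_integralE; apply: integral_ge0 => x _.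
by rewrite lee_fin.
Qed.

Lemma cfun_integral_ge_set f (A : set (borel x0)) (c : R) : measurable A ->
    (forall x, 0 <= f`[x]) -> 0 <= c -> (forall x, A x -> c <= f`[x]) ->
  (c%:E * mu A <= (cfun_integral f)%:E)%E.
Proof.
move=> mA f0 c0 fA; rewrite cfun_integralE -(integral_cst _ mA).
have /measurable_realfun.measurable_EFinP mf := cfun_measurable f.
apply: (@le_trans _ _ (\int[mu]_(x in A) (f`[x])%:E)%E).
  apply: ge0_le_integral => //.
  by apply: (measurable_funS _ _ mf).
apply: ge0_subset_integral => //.
by move=> x _; rewrite lee_fin; exact: f0.
Qed.

End borel_integral.

(** An integral against a probability is at most any upper bound of the
    integrand, which gives the norm estimate. *)
Lemma radon_probability_state (R : realType) (K : topologicalType)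
    (Kc : compact [set: K]) : radon_probabilities R Kc `<=` states R Kc.
Proof.
move=> phi [x0 [mu [_ phiE]]].
have {}phiE f : (phi : dual _) f = cfun_integral mu f.
  by apply: EFin_inj; rewrite phiE cfun_integralE.
have le_cst f M : (forall x, cfun_val f x <= M) -> (phi : dual _) f <= M.
  move=> fM; rewrite -subr_ge0 phiE.
  rewrite -[X in X - _](cfun_integral_cst (Kc := Kc) mu).
  rewrite -[- _]mulN1r addrC -cfun_integral_linear.
  apply: cfun_integral_ge0 => x.
  by rewrite cfunD !cfunZ mulN1r mulr1 addrC subr_ge0.
split.
  apply/dual_ballP => f; rewrite ler_norml; apply/andP; split.
    rewrite lerNl -dualN; apply: le_cst => x; rewrite cfunN.
    by rewrite (le_trans _ (cfun_le_norm f x))// -normrN ler_norm.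
  by apply: le_cst => x; rewrite (le_trans (ler_norm _))// cfun_le_norm.
by rewrite phiE -[cfun_one R Kc]scale1r cfun_integral_cst.
Qed.

Section riesz_representation.
Context {R : realType} {K : topologicalType} {Kc : compact [set: K]}.
Context (Kh : hausdorff_space K).
Local Notation C := (cfun R Kc).
Local Notation "f `[ x ]" := (cfun_val f x) (at level 2, format "f `[ x ]").
Context (phi : dual C) (phiS : states R Kc phi).

Section representing_measure.
Context (x0 : K).

Lemma borel_caratheodory (A : set (borel x0)) : measurable A ->
  (riesz_outer Kh phiS).-caratheodory A.
Proof.
move: A; apply: smallest_sub; last by move=> U; exact: open_caratheodory.
split=> [|A mA|A mA].
- exact: caratheodory_measurable_set0.
- by rewrite setTD; exact: caratheodory_measurable_setC.
- exact: caratheodory_measurable_bigcup.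
Qed.

Lemma representing_measure_exists : exists mu : probability (borel x0) R,
  forall A, mu A = (outer phi A)%:E.
Proof.
pose om : {outer_measure set (pointed_at x0) -> \bar R} := riesz_outer Kh phiS.
pose m : set (borel x0) -> \bar R := outerE phi.
have m_sa : semi_sigma_additive m.
  move=> A mA tA mbA.
  exact: (@caratheodory_measure_sigma_additive R (pointed_at x0) om A
    (fun n => borel_caratheodory (mA n)) tA (borel_caratheodory mbA)).
have m0 : m set0 = 0%E by exact: (outer_measure0 om).
have m_ge0 A : (0 <= m A)%E by exact: (outer_measure_ge0 om).
have mT : m setT = 1%E.
  by rewrite /m /outerE (outer_open phiS openT) innerT.
pose mm : {measure set (borel x0) -> \bar R} :=
  HB.pack m (isMeasure.Build _ _ _ m m0 m_ge0 m_sa).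
pose mu : probability (borel x0) R :=
  HB.pack (Measure.sort mm) (Measure_isProbability.Build _ _ _ mm mT).
by exists mu.
Qed.

Context (mu : probability (borel x0) R).
Context (muE : forall A, mu A = (outer phi A)%:E).

(** Inner regularity of A is outer regularity of its complement, because the
    complement of an open set is compact. *)
Lemma representing_measure_radon : radon mu.
Proof.
move=> A mA; apply/le_anti/andP; split; last first.
  apply: ge_ereal_sup => _ [B [Bc BA] <-].
  by rewrite !muE lee_fin; exact: outer_mono.
apply/lee_addgt0Pr => e e0.
have [U [Uo AU Ue]] := outer_adherent phiS (~` A) e0.
have Cc : compact (~` U).
  by apply: (subclosed_compact _ Kc) => //; exact: open_closedC.
have CA : ~` U `<=` A by rewrite -[A]setCK; exact: subsetC.
apply: (@le_trans _ _ (mu (~` U) + e%:E)%E); last first.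
  by rewrite leeD2r//; apply: ereal_sup_ubound; exists (~` U).
rewrite !muE -EFinD lee_fin.
have AC := outerC (borel_caratheodory mA).
have UC := outerC (open_caratheodory Kh phiS Uo).
rewrite (outer_open phiS Uo) in UC.
by lra.
Qed.

(** Cut f into n slices s i of height 1 / n, at the levels t i = i / n, and let
    E i be the set where f > t i. Then n s i is at most 1 and vanishes off E i,
    so that phi (s i) <= mu (E i) / n, whereas s i = 1 / n on E (i + 1), so that
    the integral of s i is at least mu (E (i + 1)) / n. The shift of the index
    costs at most 1 / n in the sum. *)
Lemma state_le_integral (f : C) : (forall x, 0 <= f`[x]) ->
  (forall x, f`[x] <= 1) -> phi f <= cfun_integral mu f.
Proof.
move=> f0 f1; apply/ler_addgt0Pr => e e0.
have [N] := ltr_add_invr e0; rewrite add0r => Ne.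
apply: le_trans (lerD (lexx _) (ltW Ne)).
pose n := N.+1; pose t (i : nat) : R := i%:R / n%:R.
have n0 : 0 < n%:R :> R by rewrite ltr0n.
have tS i : t i.+1 - t i = n%:R^-1.
  by rewrite /t -mulrBl -natrB// subSnn mul1r.
have tle i : t i <= t i.+1 by rewrite -subr_ge0 tS.
have trunc_c i : continuous (fun x => Order.min f`[x] (t i)).
  move=> x; apply: (@continuous_min _ _ (cfun_val f) (cst (t i)) x).
    exact: cfun_continuous.
  exact: cst_continuous.
pose trunc i : C := mk_cfun Kc (@trunc_c i).
pose s i := trunc i.+1 - trunc i.
have sE i x : (s i)`[x] = Order.min f`[x] (t i.+1) - Order.min f`[x] (t i).
  by [].
have s0 i x : 0 <= (s i)`[x].
  by rewrite sE subr_ge0 le_min !ge_min lexx (tle i) orbT.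
have s1 i x : (s i)`[x] <= n%:R^-1.
  rewrite sE -(tS i) lerBlDr; have [ft|tf] := leP f`[x] (t i).
    by rewrite ge_min lerDr subr_ge0 tle.
  by rewrite subrK ge_min lexx orbT.
have s_ge i x : t i.+1 < f`[x] -> n%:R^-1 <= (s i)`[x].
  move=> tf; rewrite sE min_r ?(ltW tf)// min_r ?tS//.
  by rewrite (le_trans (tle i))// ltW.
have s_out i x : f`[x] <= t i -> (s i)`[x] = 0.
  by move=> ft; rewrite sE min_l ?(le_trans ft)// min_l// subrr.
have fE : f = \sum_(i < n) s i.
  apply: cfun_eq => x; rewrite cfun_sum.
  under eq_bigr do rewrite sE.
  rewrite -(big_mkord xpredT
    (fun i => Order.min f`[x] (t i.+1) - Order.min f`[x] (t i))).
  rewrite telescope_sumr// /t divff ?gt_eqF// mul0r.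
  by rewrite min_l// min_r// subr0.
pose E i : set K := [set x | t i < f`[x]].
have Eo i : open (E i).
  have /continuousP fc := @cfun_continuous _ _ Kc f.
  exact: (fc [set y : R | t i < y] (@open_gt R (t i))).
have phi_s i : phi (s i) <= n%:R^-1 * outer phi (E i).
  rewrite mulrC ler_pdivlMr// mulrC -dualZ (outer_open phiS (Eo i)).
  apply: (inner_ge phiS); apply: belowP => x.
  - by rewrite cfunZ mulr_ge0// ltW.
  - by rewrite cfunZ mulrC -ler_pdivlMr// mul1r.
  - by move=> /negP; rewrite -leNgt => /s_out sx; rewrite cfunZ sx mulr0.
have int_s i : n%:R^-1 * outer phi (E i.+1) <= cfun_integral mu (s i).
  rewrite -lee_fin EFinM -muE; apply: cfun_integral_ge_set => //.
    by apply: sub_sigma_algebra; exact: Eo.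
  by move=> x; exact: s_ge.
rewrite {1}fE phi_sum (le_trans (ler_sum _ (fun (i : 'I_n) _ => phi_s i)))//.
rewrite [in leRHS]fE cfun_integral_sum.
rewrite big_ord_recl/= addrC lerD//; last first.
  rewrite -[leRHS]mulr1 ler_wpM2l ?invr_ge0 ?(ltW n0)//.
  by rewrite (outer_open phiS (Eo 0%N)) inner_le1.
apply: le_trans (ler_sum _ (fun (i : 'I_n) _ => int_s i)).
rewrite [leRHS]big_ord_recr/= lerDl mulr_ge0 ?invr_ge0 ?(ltW n0)//.
exact: outer_ge0.
Qed.

(** The inequality for functions g with values in [0, 1] applies to 1 - g too,
    which gives equality; an affine change of values reduces to that case. *)
Lemma state_integral (f : C) : phi f = cfun_integral mu f.
Proof.
pose one : C := cfun_one R Kc.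
(* The added 1 keeps M positive when f = 0. *)
pose M := `|f| + 1; have M0 : 0 < M by rewrite ltr_wpDl.
have fM x : `|f`[x]| <= M by rewrite (le_trans (cfun_le_norm f x))// lerDl.
have M20 : 0 < M *+ 2 by rewrite pmulrn_rgt0.
pose g : C := (M *+ 2)^-1 *: (f + M *: one).
have gE x : g`[x] = (f`[x] + M) / (M *+ 2).
  by rewrite cfunZ cfunD cfunZ mulr1 mulrC.
have g0 x : 0 <= g`[x].
  rewrite gE divr_ge0 ?(ltW M20)// -lerBlDr sub0r.
  by have := fM x; rewrite ler_norml => /andP[].
have g1 x : g`[x] <= 1.
  rewrite gE ler_pdivrMr// mul1r mulr2n lerD2r.
  by have := fM x; rewrite ler_norml => /andP[].
have phi_one : phi one = 1 by have [] := phiS.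
have gI : phi g = cfun_integral mu g.
  apply/le_anti; rewrite state_le_integral//=.
  have := @state_le_integral ((-1) *: g + 1 *: one).
  rewrite cfun_integral_linear cfun_integral_cst.
  rewrite dualD (dualZ _ _ g) (dualZ _ _ one) phi_one mulr1 lerD2r.
  rewrite !mulN1r lerN2; apply=> x.
    rewrite cfunD (cfunZ (-1) g) (cfunZ 1 one) mulN1r mul1r addrC.
    by rewrite subr_ge0 g1.
  by rewrite cfunD (cfunZ (-1) g) (cfunZ 1 one) mulN1r mul1r addrC gerBl.
have -> : f = (M *+ 2) *: g + (- M) *: one.
  apply: cfun_eq => x; rewrite cfunD (cfunZ (M *+ 2) g) (cfunZ (- M) one) gE.
  by rewrite mulrC divfK ?gt_eqF// mulr1 addrK.
rewrite dualD (dualZ _ _ g) (dualZ _ _ one) phi_one mulr1.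
by rewrite cfun_integral_linear cfun_integral_cst gI.
Qed.

End representing_measure.

Lemma state_radon_probability : radon_probabilities R Kc phi.
Proof.
have [K0|K0] := pselect ([set: K] !=set0); last first.
  have [_] := phiS; suff -> : cfun_one R Kc = 0.
    by rewrite dual0 => /esym/eqP; rewrite oner_eq0.
  by apply: cfun_eq => x; exfalso; apply: K0; exists x.
have [x0 _] := K0.
have [mu muE] := representing_measure_exists x0.
exists x0, mu; split; first exact: representing_measure_radon muE.
by move=> f; rewrite (state_integral muE) cfun_integralE.
Qed.

End riesz_representation.

Lemma radon_probabilitiesE (R : realType) (K : topologicalType)
    (Kc : compact [set: K]) : hausdorff_space K ->
  radon_probabilities R Kc = states R Kc.
Proof.
move=> Kh; rewrite eqEsubset; split; first exact: radon_probability_state.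
by move=> phi phiS; exact: state_radon_probability.
Qed.

(** * The equivalence *)

(** The states form the fiber over 1 of the evaluation at the constant function
    1. *)
Lemma skeleton_of_states (R : realType) (K : topologicalType)
    (Kc : compact [set: K]) (D : set (set_type (dual_ball (cfun R Kc)))) :
    skeleton_induced R D -> convex_set (in_dual D) ->
  exists E : set (set_type (states R Kc)),
    skeleton_induced R E /\ convex_set (in_dual E).
Proof.
move=> Dind /convex_setP Dcvx.
pose B := set_type (dual_ball (cfun R Kc)); pose G := set_type (states R Kc).
pose e (mu : G) : B := SigSub (mem_set (proj1 (state_evP mu))).
pose f (b : B) : R := (set_val b : dual (cfun R Kc)) (cfun_one R Kc).
have ec : continuous e.
  by apply: continuous_to_set_type => mu; exact: continuous_set_val.
have eI : injective e by move=> mu nu /(congr1 set_val) h; exact: val_inj.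
have fc : continuous f.
  move=> b; apply: (@continuous_comp _ _ _
    (set_val : B -> weak_star (cfun R Kc))
    (fun phi : weak_star _ => (phi : dual _) (cfun_one R Kc))).
    exact: continuous_set_val.
  exact: weak_star_eval_continuous.
have efc : range e = f @^-1` [set 1].
  rewrite eqEsubset; split=> [_ [mu _ <-]|b /= fb].
    by have [] := state_evP mu.
  have bS : states R Kc (set_val b) by split=> //; exact: (set_valP b).
  by exists (SigSub (mem_set bS)) => //; exact: val_inj.
exists (e @^-1` D); split.
  apply: (skeleton_induced_fiber (c := 1) _ _ _ ec eI fc efc Dind).
  - by apply: compact_set_type; exact: dual_ball_compact.
  - by apply: hausdorff_set_type; exact: weak_star_hausdorff.
  - by apply: compact_set_type; exact: states_compact.
apply/convex_setP => _ _ a [mu Dmu <-] [nu Dnu <-] a0 a1.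
have S := state_convex (state_evP mu) (state_evP nu) a0 a1.
exists (SigSub (mem_set S)) => //=.
have [||b Db bE] := Dcvx (state_ev mu) (state_ev nu) a _ _ a0 a1.
- by exists (e mu).
- by exists (e nu).
suff -> : e (SigSub (mem_set S)) = b by [].
by apply: val_inj; exact: esym bE.
Qed.

Theorem theorem4p1 (R : realType) (K : topologicalType)
    (Kc : compact [set: K]) (Kh : hausdorff_space K) :
  [<-> has_projectional_skeleton 1 (cfun R Kc);
       exists D : set (set_type (dual_ball (cfun R Kc))),
         [/\ skeleton_induced R D, convex_set (in_dual D)
           & symmetric_set (in_dual D)];
       exists D : set (set_type (dual_ball (cfun R Kc))),
         skeleton_induced R D /\ convex_set (in_dual D);
       exists D : set (set_type (radon_probabilities R Kc)),
         skeleton_induced R D /\ convex_set (in_dual D)].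
Proof.
rewrite (radon_probabilitiesE R Kc Kh); tfae.
- by move=> [disp [I [P [PS P1]]]]; exact: dual_ball_skeleton PS P1.
- by move=> [D [Dind Dcvx _]]; exists D.
- by move=> [D [Dind Dcvx]]; exact: skeleton_of_states Dind Dcvx.
- move=> [D [[disp [I [r [rS DE]]]] Dcvx]]; rewrite DE in Dcvx.
  exact: projectional_skeleton_of_states rS Dcvx.
Qed.
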